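(* Let $G$ be a $4K_1$-free graph and let $u,v$ be distinct vertices of $G$. If $G$ is connected, then $G$ has a path cover $\mathrm{PC}(u,v)$ if and only if all of the following hold. (a) For every articulation point $x$ of $G$ such that $G-\{x\}$ has at least 3 components, $u$ and $v$ are different from $x$ and belong to different components of $G-\{x\}$. (b) For any three articulation points $x,y,z$ of $G$ inducing a triangle in $G$: if both $u,v\notin\{x,y,z\}$, then $u$ and $v$ are not in the same component of $G-\{x,y,z\}$; and if exactly one of $u,v$, say $w$, lies in $\{x,y,z\}$, then the other one is not in the component of $G-\{x,y,z\}$ adjacent to $w$. (c) $\{u,v\}$ is not a vertex cut (not necessarily minimum) of $G$ such that $G-\{u,v\}$ has at least 3 components. (d) Let $x\neq u$ be any articulation point of $G$ such that $G-\{x\}$ has at most 2 components, let $Q_1$ be the component of $G-\{x\}$ containing $u$, and let $y\neq u$ be any articulation point of $G[Q_1]$, with $J_1$ the component of $G[Q_1]-\{y\}$ containing $u$. If $v\in J_1$, $|J_1|>2$, and the only neighbours of $x$ in $Q_1$ lie in $J_1\cup\{y\}$, then there exists $x'\in J_1$ with $x'\neq u,v$ that is adjacent to $x$ or to $y$. If $G$ is not connected, then $G$ has a path cover $\mathrm{PC}(u,v)$ if and only if $G$ has exactly 2 components, $u$ and $v$ are in different components, and neither $u$ nor $v$ is an articulation point of its component.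
   Context: Graphs are finite, simple and undirected. A graph is $4K_1$-free if it contains no four pairwise non-adjacent vertices. $G[A]$ denotes the subgraph induced by $A$. A path cover $\mathrm{PC}(u,v)$ of $G$ is a pair of vertex-disjoint paths which together contain all vertices of $G$, one starting (having an end-vertex) at $u$ and the other starting at $v$ (a single vertex is a path). A vertex cut of $H$ is a set $A\subset V(H)$ with $H-A$ disconnected; an articulation point is a vertex $x$ with $H-\{x\}$ disconnected. A component of $G-\{x,y,z\}$ is adjacent to a vertex $w$ if it contains a neighbour of $w$. *)

(* Defs.v *)
From mathcomp Require Import all_boot.

Set Implicit Arguments.
Unset Strict Implicit.
Unset Printing Implicit Defensive.

(* A simple graph on a finite type T is a symmetric irreflexive e : rel T;
   these two properties are hypotheses of the theorem.  The induced subgraph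
   G[A] is represented by its vertex set A : {set T}, so G itself is [set: T]
   and G - A is ~: A. *)

Section Graph.

Variables (T : finType) (e : rel T).

Implicit Types (A C : {set T}) (w x : T).

Definition induced A : rel T := [rel a b | [&& a \in A, b \in A & e a b]].

Definition components A : {set {set T}} :=
  equivalence_partition (connect (induced A)) A.

(* The empty graph counts as connected, so "G[A] is disconnected" always means
   that it has at least two components. *)
Definition connected A : bool :=
  [forall a in A, forall b in A, connect (induced A) a b].

Definition articulation A x : bool := (x \in A) && ~~ connected (A :\ x).

Definition vertex_cut A : bool := ~~ connected (~: A).

Definition adjacent_to C w : bool := [exists c in C, e w c].

Definition stable A : bool := [forall a in A, forall b in A, ~~ e a b].

Definition free_4K1 : Prop := forall A, stable A -> #|A| <> 4.

Definition separated A u v : Prop :=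
  forall C, C \in components A -> ~ (u \in C /\ v \in C).

(* The two paths are u :: p and v :: q; p or q may be empty. *)
Definition path_cover u v : Prop :=
  exists p q : seq T,
    [/\ path e u p, path e v q, uniq ((u :: p) ++ (v :: q))
      & forall w, w \in (u :: p) ++ (v :: q)].

Definition cond_a u v : Prop :=
  forall x, articulation [set: T] x -> 3 <= #|components (~: [set x])| ->
    [/\ u <> x, v <> x & separated (~: [set x]) u v].

(* For w in {x, y, z}, "the component adjacent to w" is read as any component
   of G - {x, y, z} containing a neighbour of w. *)
Definition cond_b u v : Prop :=
  forall x y z,
    articulation [set: T] x -> articulation [set: T] y ->
    articulation [set: T] z -> e x y -> e y z -> e x z ->
    let S := [set x; y; z] in
    (u \notin S -> v \notin S -> separated (~: S) u v) /\
    (forall w w', (w = u /\ w' = v) \/ (w = v /\ w' = u) ->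
       w \in S -> w' \notin S ->
       forall C, C \in components (~: S) -> adjacent_to C w -> w' \notin C).

Definition cond_c u v : Prop :=
  ~ (vertex_cut [set u; v] /\ 3 <= #|components (~: [set u; v])|).

Definition cond_d u v : Prop :=
  forall x (Q1 : {set T}) y (J1 : {set T}),
    x <> u -> articulation [set: T] x -> #|components (~: [set x])| <= 2 ->
    Q1 \in components (~: [set x]) -> u \in Q1 ->
    y <> u -> articulation Q1 y ->
    J1 \in components (Q1 :\ y) -> u \in J1 ->
    v \in J1 -> 2 < #|J1| ->
    (forall w, w \in Q1 -> e x w -> w \in J1 \/ w = y) ->
    exists x', [/\ x' \in J1, x' <> u, x' <> v & e x x' \/ e y x'].

Definition cond_disconnected u v : Prop :=
  [/\ #|components [set: T]| = 2, separated [set: T] u v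
    & forall C, C \in components [set: T] ->
        (u \in C -> ~~ articulation C u) /\ (v \in C -> ~~ articulation C v)].

End Graph.

(* Main.v *)
(* Sufficiency.  Take disjoint paths from u and v, with other ends a and b,
   covering as many vertices as possible; u and v play the role of consecutive
   vertices of one long path.  If some vertices are uncovered, then no longer
   pair obtained by a rotation may exist, which makes many pairs of vertices
   non-adjacent.  As there is no 4K_1, the uncovered vertices form a clique, and
   the covered vertices adjacent to it are either exactly u and v, or a single
   articulation point x.  In each case the remaining covered vertices induce no
   3K_1 and have a very restricted structure (two cliques joined through one or
   two vertices, or, for x = u, a graph with a Hamiltonian path from any vertex
   that does not disconnect it), and one of (a)-(d) fails.

   Necessity.  A set attached to the rest of the graph, with the edge uv added,
   by a single vertex contains a or b.  A failure of (b) yields three disjoint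
   such sets; a failure of (d) yields two, and a third set which is only
   attached to u and v and thus also contains a or b.  Conditions (a) and (c)
   count the pieces into which the two paths are cut. *)
Require Import Defs.
From mathcomp Require Import all_boot zify.

Set Implicit Arguments.
Unset Strict Implicit.
Unset Printing Implicit Defensive.

(** * Paths with prescribed ends *)

(** Every rotation argument on a maximal pair has one shape. Four vertices are chosen among
    uncovered vertices, path ends, and vertices next to a place where a path can be cut. One of the
    six possible edges exists, and all, or all but one, of them would give a longer pair: the
    outcome is a contradiction or a forced edge, and the forced edges are where the cliques come
    from. Only the starts [u] and [v] are fixed, so a re-routing may hand the tail of one path over
    to the other; this plays the part of the edge [uv], which need not exist. A re-routed pair is
    longer as soon as its lists are a permutation of the old lists together with some uncovered
    vertices, so each case amounts to a concatenation of segments and a count. *)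

Ltac count_perm :=
  apply/permP => ?; repeat progress rewrite ?(count_cat, count_rev) /=;
  repeat match goal with
    | |- context [nat_of_bool ?b] => move: (nat_of_bool b)
    | |- context [count ?p ?s] => move: (count p s)
    end; clear; lia.

Section Segments.

Variables (T : finType) (r : rel T).
Implicit Types (x y z : T) (s t l : seq T).

(** Unlike in [path], the list holds both ends, so gluing two paths along an edge is plain
    concatenation, and covering a vertex is list membership. *)
Definition seg x y s :=
  if s is z :: s' then [&& z == x, path r z s' & last z s' == y] else false.

Lemma seg1 x : seg x x [:: x].
Proof. by rewrite /seg /= !eqxx. Qed.

Lemma seg_path x y p : path r x p -> last x p = y -> seg x y (x :: p).
Proof. by move=> rp <-; rewrite /seg !eqxx rp. Qed.

Lemma segP x y s :
  seg x y s -> exists p, [/\ s = x :: p, path r x p & last x p = y].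
Proof. by case: s => //= z s /and3P[/eqP-> rp /eqP<-]; exists s. Qed.

Lemma seg_cat x y z w s t : seg x y s -> r y z -> seg z w t -> seg x w (s ++ t).
Proof.
move=> /segP[p [-> rp lp]] ryz /segP[q [-> rq lq]].
by apply: seg_path; rewrite ?cat_path ?last_cat //= lp rp ryz.
Qed.

Lemma seg_head x y s : seg x y s -> x \in s.
Proof. by case/segP=> p [-> _ _]; rewrite mem_head. Qed.

Lemma seg_last x y s : seg x y s -> y \in s.
Proof. by case/segP=> p [-> _ <-]; rewrite mem_last. Qed.

Lemma seg_after x y z s : seg x y s -> z \in s -> z != y ->
  exists s1 s2 z', [/\ s = s1 ++ s2, seg x z s1, r z z' & seg z' y s2].
Proof.
case/segP=> p [-> rp lp] zp; move: lp rp; case/splitPl: zp => p1 p2 lp1.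
rewrite last_cat cat_path lp1 => lp2 /andP[rp1 rp2] zy.
case: p2 lp2 rp2 => [/eqP|z' p2 /= lp2 /andP[rz rp2]]; first by rewrite (negPf zy).
by exists (x :: p1), (z' :: p2), z'; split=> //; apply: seg_path.
Qed.

Lemma seg_before x y z s : seg x y s -> z \in s -> z != x ->
  exists s1 s2 z', [/\ s = s1 ++ s2, seg x z' s1, r z' z & seg z y s2].
Proof.
case/segP=> p [-> rp lp]; rewrite inE => /predU1P[->|zp]; first by rewrite eqxx.
move=> _; move: lp rp; case/splitPr: zp => p1 p2.
rewrite last_cat cat_path /= => lp2 /and3P[rp1 rz rp2].
by exists (x :: p1), (z :: p2), (last x p1); split=> //; apply: seg_path.
Qed.

Lemma seg_behead x y s : seg x y s -> y != x ->
  exists x' s', [/\ s = x :: s', r x x' & seg x' y s'].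
Proof.
case/segP=> -[|x' p] [-> /= rp lp yx]; first by rewrite -lp eqxx in yx.
by case/andP: rp => rx rp; exists x', (x' :: p); split=> //; apply: seg_path.
Qed.

Lemma seg_loop x s : seg x x s -> uniq s -> s = [:: x].
Proof.
case/segP=> p [-> rp]; case/lastP: p {rp} => // p z; rewrite last_rcons => ->.
by rewrite /= mem_rcons mem_head.
Qed.

Hypothesis r_sym : symmetric r.

Lemma seg_rev x y s : seg x y s -> seg y x (rev s).
Proof.
case/segP=> p [->]; elim: p x => [|z p IHp] x /=; first by move=> _ ->; apply: seg1.
move=> /andP[rxz rp] lp; rewrite rev_cons -cats1.
by apply: seg_cat (IHp z rp lp) _ (seg1 x); rewrite r_sym.
Qed.

(** An edge between the ends closes the path to a cycle, which can be cut open at [z]; [x = y] is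
    the one-vertex path. *)
Lemma seg_rotate x y z s : seg x y s -> uniq s -> x = y \/ r x y -> z \in s ->
  exists y' s', seg z y' s' /\ perm_eq s' s.
Proof.
move=> ss us; have [-> _|zx] := eqVneq z x; first by exists y, s.
case=> [xy|rxy] zs.
  by rewrite -xy in ss; rewrite (seg_loop ss us) inE (negPf zx) in zs.
have [s1 [s2 [o [-> s1P roz s2P]]]] := seg_before ss zs zx.
exists o, (s2 ++ s1); split; last by rewrite perm_catC.
by apply: seg_cat s2P _ s1P; rewrite r_sym.
Qed.

Definition clique s := forall x y, x \in s -> y \in s -> x != y -> r x y.

Lemma clique_perm s t : perm_eq s t -> clique s -> clique t.
Proof. by move=> st cs x y; rewrite -!(perm_mem st); apply: cs. Qed.

Lemma clique_path s x : clique (x :: s) -> uniq (x :: s) -> path r x s.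
Proof.
elim: s x => //= y s IHs x cs /and3P[xys ys us]; apply/andP; split.
  apply: cs; rewrite ?inE ?eqxx ?orbT //.
  by apply: contraNneq xys => ->; rewrite mem_head.
by apply: IHs => [z w zs ws|]; [apply: cs; rewrite inE ?zs ?ws orbT | rewrite /= ys].
Qed.

Lemma clique_seg s x y : clique s -> uniq s -> x \in s -> y \in s -> x != y ->
  exists2 s', seg x y s' & perm_eq s' s.
Proof.
move=> cs us xs ys xy; set s' := x :: rcons (rem y (rem x s)) y.
have yx : y \in rem x s by rewrite mem_rem_uniq // !inE eq_sym xy.
have ps : perm_eq s' s.
  rewrite perm_sym (perm_trans (perm_to_rem xs)) // perm_cons perm_sym perm_rcons.
  by rewrite perm_sym; apply: perm_to_rem.
exists s' => //; apply: seg_path; last by rewrite last_rcons.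
apply: clique_path; last by rewrite (perm_uniq ps).
by apply: clique_perm cs; rewrite perm_sym.
Qed.

End Segments.

(** * Components *)

(** Duplicate-free lists have length at most [#|T|]. The predicate is arbitrary, so as to serve a
    single path as well as the concatenation of a pair. *)
Lemma longest_seq (T : finType) (P : pred (seq T)) s0 :
  P s0 -> (forall s, P s -> uniq s) ->
  exists2 s, P s & forall s', P s' -> size s' <= size s.
Proof.
move=> Ps0 Pu; pose Q n := [exists t : n.-tuple T, P t].
have QP s : P s -> Q (size s) by move=> Ps; apply/existsP; exists (in_tuple s).
have Qb n : Q n -> n <= #|T|.
  by case/existsP=> t /Pu/card_uniqP; rewrite size_tuple => <-; apply: max_card.
have exQ : exists n, Q n by exists (size s0); apply: QP.
have [n /existsP[t Pt] maxn] := ex_maxnP exQ Qb.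
by exists t => // s' /QP/maxn; rewrite size_tuple.
Qed.

Section Components.

Variables (T : finType) (e : rel T) (e_sym : symmetric e).
Implicit Types (A B C F : {set T}) (x y z w : T) (s t : seq T).

Local Notation linked A := (connect (induced e A)).

Lemma linked_sym A : connect_sym (induced e A).
Proof. by apply: sym_connect_sym => x y; rewrite /induced /= e_sym andbCA. Qed.

Lemma linked1 A x y : x \in A -> y \in A -> e x y -> linked A x y.
Proof. by move=> xA yA exy; apply: connect1; rewrite /induced /= xA yA. Qed.

(** The certificate for non-linkage: a closed set containing one vertex and missing another shows
    that no path inside [A] joins them. *)
Definition closed_in A C :=
  forall x y, x \in C -> y \in A -> e x y -> y \in C.

Lemma linked_closed A C x y : closed_in A C -> linked A x y -> x \in C -> y \in C.
Proof.
move=> clC /connectP[p ip ->] {y}; elim: p x ip => //= y p IHp x /andP[ixy ip] xC.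
by case/and3P: ixy => _ yA exy; apply: IHp ip _; apply: clC exy.
Qed.

Lemma linked_mem A x y : linked A x y -> x \in A -> y \in A.
Proof. by apply: linked_closed => ? ? _ ->. Qed.

(** A walk cannot leave the closed part [F], so vertices unlinked in [F] stay unlinked in [A]:
    components of [F] may be counted in [A]. *)
Lemma linked_restrict A F x y :
  F \subset A -> closed_in A F -> x \in F -> linked A x y -> linked F x y.
Proof.
move=> sFA clF xF /connectP[p ip ->] {y}.
elim: p x xF ip => [|y p IHp] x xF /=; first by rewrite connect0.
case/andP=> /and3P[_ yA exy] ip; have yF : y \in F by apply: clF exy.
by apply: connect_trans (linked1 xF yF exy) _; apply: IHp.
Qed.

Lemma seg_linked A x y z s :
  seg e x y s -> {subset s <= A} -> z \in s -> linked A x z.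
Proof.
case/segP=> p [-> ep _] sA; rewrite inE => /predU1P[->|]; first exact: connect0.
elim: p x ep sA => //= w p IHp x /andP[exw ep] sA zwp.
have xA : x \in A by apply: sA; rewrite !inE eqxx.
have wA : w \in A by apply: sA; rewrite !inE eqxx orbT.
apply: connect_trans (linked1 xA wA exw) _.
case/predU1P: zwp => [->|zp]; first exact: connect0.
by apply: IHp => // a ap; apply: sA; rewrite inE ap orbT.
Qed.

Lemma clique_linked A x y s :
  clique e s -> {subset s <= A} -> x \in s -> y \in s -> linked A x y.
Proof.
move=> cs sA xs ys; have [->|xy] := eqVneq x y; first exact: connect0.
by apply: linked1; [apply: sA | apply: sA | apply: cs].
Qed.

Definition comp_of A x := [set y in A | linked A x y].

Lemma comp_of_in A x : x \in A -> comp_of A x \in components e A.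
Proof. exact: imset_f. Qed.

Lemma mem_comp_of A x : x \in A -> x \in comp_of A x.
Proof. by move=> xA; rewrite inE xA connect0. Qed.

Lemma comp_ofP A C x : C \in components e A -> x \in C -> C = comp_of A x.
Proof.
case/imsetP=> x0 x0A ->; rewrite inE => /andP[xA x0x].
by apply/setP=> y; rewrite !inE (same_connect (@linked_sym A) x0x).
Qed.

Lemma comp_sub A C x : C \in components e A -> x \in C -> x \in A.
Proof. by case/imsetP=> x0 _ ->; rewrite inE => /andP[]. Qed.

Lemma comp_linked A C x y :
  C \in components e A -> x \in C -> (y \in C) = linked A x y.
Proof.
move=> CA xC; have xA := comp_sub CA xC; rewrite (comp_ofP CA xC) inE.
by apply: andb_idl => /linked_mem->.
Qed.

Lemma comp_closed A C : C \in components e A -> closed_in A C.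
Proof.
move=> CA x y xC yA exy; rewrite (comp_linked _ CA xC).
by apply: linked1 => //; apply: comp_sub xC.
Qed.

Lemma is_component A C x :
  C \subset A -> x \in C -> (forall y, y \in C -> linked A x y) ->
  closed_in A C -> C \in components e A.
Proof.
move=> /subsetP sCA xC xC_linked clC; suff ->: C = comp_of A x.
  by apply/comp_of_in/sCA.
apply/setP=> y; rewrite inE; apply/idP/andP=> [yC|[_ xy]].
  by split; [apply: sCA | apply: xC_linked].
exact: linked_closed xy xC.
Qed.

Lemma linked_not_separated A x y :
  x \in A -> linked A x y -> ~ separated e A x y.
Proof.
move=> xA xy /(_ _ (comp_of_in xA)); apply.
by rewrite !inE xA connect0 xy (linked_mem xy xA).
Qed.

Lemma separatedPn A x y : ~~ linked A x y -> separated e A x y.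
Proof.
by move=> nxy C CA [xC yC]; rewrite -(comp_linked y CA xC) yC in nxy.
Qed.

Lemma card_components_le A s :
  (forall x, x \in A -> exists2 y, y \in s & linked A y x) ->
  #|components e A| <= size s.
Proof.
move=> sP; rewrite -(size_map (comp_of A)).
apply: leq_trans (card_size _); apply/subset_leq_card/subsetP=> C.
case/imsetP=> x /[dup] xA /sP[y ys yx] ->; apply/mapP; exists y => //.
by apply/setP=> z; rewrite !inE (same_connect (@linked_sym A) yx).
Qed.

Lemma card_components_ge3 A x y z :
  x \in A -> y \in A -> z \in A ->
  ~~ linked A x y -> ~~ linked A x z -> ~~ linked A y z ->
  3 <= #|components e A|.
Proof.
move=> xA yA zA xy xz yz.
have ne a b : a \in A -> b \in A -> ~~ linked A a b -> comp_of A a != comp_of A b.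
  move=> aA bA; apply: contraNneq => ab.
  by have := mem_comp_of bA; rewrite -ab inE => /andP[].
rewrite -[3]/(size [:: comp_of A x; comp_of A y; comp_of A z]).
rewrite -(card_uniqP _); last by rewrite /= !inE negb_or !ne.
apply/subset_leq_card/subsetP=> C.
by rewrite !inE => /or3P[]/eqP->; apply: comp_of_in.
Qed.

Lemma connectedP A :
  reflect {in A &, forall x y, linked A x y} (connected e A).
Proof.
apply: (iffP idP) => [/forall_inP cA x y xA yA|cA].
  by have /forall_inP := cA x xA; apply.
by apply/forall_inP=> x xA; apply/forall_inP=> y yA; apply: cA.
Qed.

Lemma connectedPn A :
  reflect (exists x y, [/\ x \in A, y \in A & ~~ linked A x y]) (~~ connected e A).
Proof.
apply: (iffP idP) => [|[x [y [xA yA nxy]]]].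
  by case/forall_inPn=> x xA /forall_inPn[y yA nxy]; exists x, y.
by apply: contra nxy => /connectedP; apply.
Qed.

Lemma card_components_ge2 A :
  ~~ connected e A -> 2 <= #|components e A|.
Proof.
case/connectedPn=> x [y [xA yA xy]].
have ne : comp_of A x != comp_of A y.
  apply: contraNneq xy => ab.
  by have := mem_comp_of yA; rewrite -ab inE => /andP[].
rewrite -[2]/(size [:: comp_of A x; comp_of A y]).
rewrite -(card_uniqP _); last by rewrite /= !inE ne.
apply/subset_leq_card/subsetP=> C.
by rewrite !inE => /orP[]/eqP->; apply: comp_of_in.
Qed.

Lemma connected_edge A B :
  connected e A -> B \subset A -> B != set0 -> B != A ->
  exists x y, [/\ x \in B, y \in A, y \notin B & e x y].
Proof.
move=> /connectedP cA sBA /set0Pn[x xB] nBA.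
have /properP[_ [y yA yB]] : B \proper A by rewrite properEneq nBA.
have := cA x y (subsetP sBA x xB) yA.
case: (boolP [exists a in B, exists b in A :\: B, e a b]).
  case/exists_inP=> a aB /exists_inP[b]; rewrite inE => /andP[bB bA] eab _.
  by exists a, b.
move/exists_inPn=> nab xy; case/negP: yB; apply: linked_closed xy xB.
move=> a b aB bA eab; apply: contraT => bB.
by case/exists_inP: (nab a aB); exists b; rewrite // inE bB.
Qed.

Hypothesis e_irr : irreflexive e.

Lemma free_4K1_edge a b c d : free_4K1 e -> uniq [:: a; b; c; d] ->
  [|| e a b, e a c, e a d, e b c, e b d | e c d].
Proof.
move=> free us; apply: contraT; rewrite !negb_or => /and5P[ab ac ad bc /andP[bd cd]].
case: (free [set x in [:: a; b; c; d]]); last by rewrite cardsE; apply/card_uniqP.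
apply/forall_inP=> x; rewrite !inE => xs; apply/forall_inP=> y; rewrite !inE => ys.
by case/or4P: xs => /eqP->; case/or4P: ys => /eqP->; rewrite ?e_irr // e_sym.
Qed.

Definition free_3K1_on A :=
  forall x y z, x \in A -> y \in A -> z \in A -> uniq [:: x; y; z] ->
  [|| e x y, e x z | e y z].

(* Of a longest path v ... o p ... b, with p <> v adjacent to an uncovered
   vertex h, the vertices h, o and b are independent. *)
Lemma hamiltonian_path_from F v :
  free_3K1_on F -> connected e F -> v \in F -> ~~ articulation e F v ->
  exists b s, [/\ seg e v b s, uniq s & s =i F].
Proof.
move=> F3 cF vF nav.
pose P s := [&& seg e v (last v s) s, uniq s & all (mem F) s].
have Pseg b s : seg e v b s -> uniq s -> {subset s <= F} -> P s.
  move=> sP us /allP sF; rewrite /P us sF !andbT.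
  by case/segP: sP => p [-> ep _]; apply: seg_path.
have P1 : P [:: v] by apply: Pseg (seg1 _ _) _ _ => // x; rewrite inE => /eqP->.
have Pu s : P s -> uniq s by case/and3P.
have [s /and3P[sP us /allP sF0] smax] := longest_seq P1 Pu.
have {sF0} sF : {subset s <= F} := sF0.
exists (last v s), s; split=> // x; apply/idP/idP; first exact: sF.
move=> xF; apply: contraT => xs; set b := last v s in sP.
have grow b' s' h : h \in F -> h \notin s -> perm_eq s' (h :: s) ->
    ~ seg e v b' s'.
  move=> hF hs ps s'P; have us' : uniq s' by rewrite (perm_uniq ps) /= hs.
  have: P s'.
    apply: Pseg s'P us' _ => y; rewrite (perm_mem ps) inE => /predU1P[->|/sF] //.
  by move/smax; rewrite (perm_size ps) /= ltnn.
have bh h : h \in F -> h \notin s -> ~~ e b h.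
  move=> hF hs; apply/negP=> ebh; apply: (grow h (s ++ [:: h]) h) => //.
    by rewrite perm_catC.
  exact: seg_cat sP ebh (seg1 _ _).
have vs : v \in s := seg_head sP.
(* If [b = v], the path is the single vertex [v], and connectedness of [F] extends it. Otherwise [F]
   without [v] is still connected, so some edge to an uncovered vertex starts at a [p] other than
   [v], which has a predecessor. *)
have [p [h [ps pv hF hs eph]]] : exists p h,
    [/\ p \in s, p != v, h \in F, h \notin s & e p h].
  case: (eqVneq b v) => [bv|bv].
    have [] := @connected_edge F [set y in s] cF.
    - by apply/subsetP=> y; rewrite inE => /sF.
    - by apply/set0Pn; exists v; rewrite inE.
    - by apply: contraNneq xs => sEF; rewrite -sEF inE in xF.
    rewrite bv in sP bh; rewrite (seg_loop sP us) in bh * => p [h []].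
    rewrite !inE => /eqP-> hF hv evh.
    by have := bh h hF; rewrite inE hv evh => /(_ isT).
  move: nav; rewrite /articulation vF negbK => cFv.
  have [] := @connected_edge (F :\ v) [set y in s | y != v] cFv.
  - by apply/subsetP=> y; rewrite !inE => /andP[/sF-> ->].
  - by apply/set0Pn; exists b; rewrite !inE bv (seg_last sP).
  - apply: contraNneq xs => /setP/(_ x); rewrite !inE xF andbT.
    by case: eqVneq => [->|_]; rewrite ?vs // andbT => ->.
  move=> p [h []]; rewrite !inE => /andP[ps pv] /andP[hv hF].
  by rewrite hv andbT => hs eph; exists p, h.
have [s1 [s2 [o [sE s1P eop s2P]]]] := seg_before sP ps pv.
have os1 := seg_last s1P; have bs2 := seg_last s2P.
have us12 : uniq (s1 ++ s2) by rewrite -sE.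
have osF : o \in F by apply: sF; rewrite sE mem_cat os1.
have bF : b \in F by apply: sF; rewrite sE mem_cat bs2 orbT.
have ho : h != o by apply: contraNneq hs => ->; rewrite sE mem_cat os1.
have hb : h != b by apply: contraNneq hs => ->; rewrite sE mem_cat bs2 orbT.
have ob : o != b.
  apply: contraTneq os1 => ->; move: us12; rewrite cat_uniq => /and3P[_ nos _].
  by apply: contra nos => bs1; apply/hasP; exists b.
have := F3 h o b hF osF bF; rewrite /= !inE negb_or ho hb ob => /(_ isT).
(* The edge [ho] inserts [h] between [o] and [p]; the edge [ob] reverses the tail, which then ends
   in [p] and goes on to [h]. *)
rewrite (e_sym h b) (negPf (bh h hF hs)) /= => /orP[eho|eob]; exfalso.
  apply: (grow b (s1 ++ [:: h] ++ s2) h) => //; first by rewrite sE; count_perm.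
  by apply: seg_cat s1P _ (seg_cat (seg1 _ _) _ s2P); rewrite // e_sym.
apply: (grow h (s1 ++ rev s2 ++ [:: h]) h) => //; first by rewrite sE; count_perm.
exact: seg_cat s1P eob (seg_cat (seg_rev e_sym s2P) eph (seg1 _ _)).
Qed.

End Components.

(** * Maximal pairs of paths *)

Lemma uniq_cat_neq (T : eqType) (s t : seq T) x y :
  uniq (s ++ t) -> x \in s -> y \in t -> x != y.
Proof.
rewrite cat_uniq => /and3P[_ /hasPn st _] xs /st; apply: contraNneq => /= <-.
exact: xs.
Qed.

Section Maximal.

Variables (T : finType) (e : rel T) (e_sym : symmetric e) (e_irr : irreflexive e).
Hypotheses (free : free_4K1 e) (e_conn : connected e [set: T]).
Implicit Types (x y z w h u v a b : T) (s t l : seq T).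

(** Maximality ranges over pairs with arbitrary other ends and compares total length only, so
    vertices may move from one path to the other. *)
Record maxcov u v a b s t : Prop := MaxCov {
  mc_s : seg e u a s;
  mc_t : seg e v b t;
  mc_uniq : uniq (s ++ t);
  mc_max : forall a' b' s' t', seg e u a' s' -> seg e v b' t' ->
    uniq (s' ++ t') -> size (s' ++ t') <= size (s ++ t) }.

Lemma maxcov_swap u v a b s t : maxcov u v a b s t -> maxcov v u b a t s.
Proof.
case=> sP tP us smax; split; rewrite // ?(uniq_catC t) // => a' b' s' t' s'P t'P.
rewrite uniq_catC => us'; have := smax _ _ _ _ t'P s'P us'.
by rewrite !size_cat [X in X <= _]addnC [X in _ <= X]addnC.
Qed.

(** The contradiction behind every re-routing: a pair on exactly the covered vertices and a nonempty
    list [l] of uncovered ones would be longer. *)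
Lemma mc_grow u v a b s t h h' l a' b' s' t' :
  maxcov u v a b s t -> seg e h h' l -> uniq l ->
  (forall z, z \in l -> z \notin s ++ t) ->
  seg e u a' s' -> seg e v b' t' -> ~ perm_eq (s' ++ t') (l ++ (s ++ t)).
Proof.
move=> M lP ul lst s'P t'P ps.
have us' : uniq (s' ++ t').
  rewrite (perm_uniq ps) cat_uniq ul (mc_uniq M) andbT; apply/hasPn=> z.
  by apply: contraL; apply: lst.
have := mc_max M s'P t'P us'; rewrite (perm_size ps) (size_cat l) -[X in _ <= X]add0n.
by rewrite leq_add2r; case/segP: lP => p [-> _ _].
Qed.

Lemma mc_grow1 u v a b s t h a' b' s' t' :
  maxcov u v a b s t -> h \notin s ++ t ->
  seg e u a' s' -> seg e v b' t' -> ~ perm_eq (s' ++ t') (h :: s ++ t).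
Proof.
move=> M hst; apply: (mc_grow M (seg1 e h)) => // z.
by rewrite inE => /eqP->.
Qed.

Lemma mc_end u v a b s t h :
  maxcov u v a b s t -> h \notin s ++ t -> ~~ e a h.
Proof.
move=> M hst; apply/negP=> eah.
apply: (mc_grow1 M hst (seg_cat (mc_s M) eah (seg1 _ h)) (mc_t M)).
count_perm.
Qed.

(** The edge [ab] would hand the part of [s] behind [x] over to [t], reversed, and leave [x] free to
    go on to [h]. *)
Lemma mc_ends_of u v a b s t x h :
  maxcov u v a b s t -> x \in s -> h \notin s ++ t -> e x h -> ~~ e a b.
Proof.
move=> M xs hst exh; apply/negP=> eab.
have xa : x != a by apply: contraTneq exh => ->; apply: mc_end M hst.
have [s1 [s2 [x' [sE s1P _ s2P]]]] := seg_after (mc_s M) xs xa.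
apply: (mc_grow1 M hst (seg_cat s1P exh (seg1 _ h))
  (seg_cat (mc_t M) _ (seg_rev e_sym s2P))); first by rewrite e_sym.
rewrite sE; count_perm.
Qed.

Lemma mc_touch u v a b s t h0 : maxcov u v a b s t -> h0 \notin s ++ t ->
  exists x h, [/\ x \in s ++ t, h \notin s ++ t & e x h].
Proof.
move=> M h0st; have [] := @connected_edge _ e [set: T] [set z in s ++ t] e_conn.
- by apply/subsetP.
- by apply/set0Pn; exists u; rewrite inE mem_cat (seg_head (mc_s M)).
- by apply: contraNneq h0st => /setP/(_ h0); rewrite !inE.
by move=> x [h []]; rewrite !inE => xst _ hst exh; exists x, h.
Qed.

Lemma mc_ends u v a b s t h0 :
  maxcov u v a b s t -> h0 \notin s ++ t -> ~~ e a b.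
Proof.
move=> M /(mc_touch M)[x [h [+ hst exh]]]; rewrite mem_cat => /orP[xs|xt].
  exact: mc_ends_of M xs hst exh.
rewrite e_sym; apply: mc_ends_of (maxcov_swap M) xt _ exh.
by rewrite mem_cat orbC -mem_cat.
Qed.

Lemma mc_out_neq s h x : h \notin s -> x \in s -> h != x.
Proof. by move=> hs xs; apply: contraNneq hs => ->. Qed.

Lemma out_swap s t h : (h \notin s ++ t) = (h \notin t ++ s).
Proof. by rewrite !mem_cat orbC. Qed.

(** Among [a], [b], [h], [h'] every other edge is excluded. *)
Lemma mc_out_edge u v a b s t h h' : maxcov u v a b s t ->
  h \notin s ++ t -> h' \notin s ++ t -> h != h' -> e h h'.
Proof.
move=> M hst h'st hh'; have M' := maxcov_swap M.
have as_ := seg_last (mc_s M); have bt := seg_last (mc_t M).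
have ast : a \in s ++ t by rewrite mem_cat as_.
have bst : b \in s ++ t by rewrite mem_cat bt orbT.
have := @free_4K1_edge _ e e_sym e_irr a b h h' free.
rewrite /= !inE !negb_or (uniq_cat_neq (mc_uniq M) as_ bt) hh'.
rewrite !(eq_sym _ h) !(eq_sym _ h') !(mc_out_neq _ ast) // !(mc_out_neq _ bst) //.
move/(_ isT); rewrite (negPf (mc_ends M hst)) !(negPf (mc_end M _)) //.
by rewrite !(negPf (mc_end M' _)) // out_swap.
Qed.

(** The detour through the uncovered clique between two attachments, with [h = h'] and [h != h']
    treated alike. *)
Lemma mc_link u v a b s t h h' : maxcov u v a b s t ->
  h \notin s ++ t -> h' \notin s ++ t ->
  exists l, [/\ seg e h h' l, uniq l & forall z, z \in l -> z \notin s ++ t].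
Proof.
move=> M hst h'st; have [<-|hh'] := eqVneq h h'.
  by exists [:: h]; split=> [||z]; rewrite ?seg1 // inE => /eqP->.
exists [:: h; h']; split=> [||z].
- exact: seg_cat (seg1 _ _) (mc_out_edge M hst h'st hh') (seg1 _ _).
- by rewrite /= inE hh'.
- by rewrite !inE => /orP[]/eqP->.
Qed.

(** With [x] before [y] on the same path, [h], [b] and the successors [x'], [y'] are independent.
    The edge [x'y'] is answered by a detour from [x] through uncovered vertices to [y], back to
    [x'], and on to [y']. *)
Lemma mc_attach_ordered u v a b s t s1 s2 s3 x x' y y' h h' :
  maxcov u v a b s t -> s = s1 ++ s2 ++ s3 ->
  seg e u x s1 -> e x x' -> seg e x' y s2 -> e y y' -> seg e y' a s3 ->
  h \notin s ++ t -> h' \notin s ++ t -> e x h -> e y h' -> False.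
Proof.
move=> M sE s1P exx' s2P eyy' s3P hst h'st exh eyh'; have M' := maxcov_swap M.
have [l [lP ul lst]] := mc_link M hst h'st.
have bst : b \in s ++ t by rewrite mem_cat (seg_last (mc_t M)) orbT.
have x's2 := seg_head s2P; have y's3 := seg_head s3P.
have x's : x' \in s by rewrite sE !mem_cat x's2 orbT.
have y's : y' \in s by rewrite sE !mem_cat y's3 !orbT.
have x'st : x' \in s ++ t by rewrite mem_cat x's.
have y'st : y' \in s ++ t by rewrite mem_cat y's.
have x'y' : x' != y'.
  have := mc_uniq M; rewrite sE -!catA uniq_catCA => us.
  by apply: uniq_cat_neq us x's2 _; rewrite !mem_cat y's3 orbT.
have bx z : z \in s -> b != z.
  by move=> zs; rewrite eq_sym (uniq_cat_neq (mc_uniq M) zs (seg_last (mc_t M))).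
have := @free_4K1_edge _ e e_sym e_irr h b x' y' free.
rewrite /= !inE !negb_or !(mc_out_neq hst) // !bx // x'y' => /(_ isT).
rewrite e_sym (negPf (mc_end M' _)) 1?out_swap //=.
case/or4P=> [ehx'|ehy'|ebx'|/orP[eby'|ex'y']].
- apply: (mc_grow1 M hst (seg_cat s1P exh (seg_cat (seg1 _ _) ehx'
    (seg_cat s2P eyy' s3P))) (mc_t M)).
  rewrite sE; count_perm.
- rewrite e_sym in ehy'.
  apply: (mc_grow M lP ul lst (seg_cat s1P exx' (seg_cat s2P eyh'
    (seg_cat (seg_rev e_sym lP) _ s3P))) (mc_t M)); first by rewrite e_sym.
  rewrite sE; count_perm.
- apply: (mc_grow1 M hst (seg_cat s1P exh (seg1 _ _))
    (seg_cat (mc_t M) ebx' (seg_cat s2P eyy' s3P))).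
  rewrite sE; count_perm.
- apply: (mc_grow1 M h'st (seg_cat s1P exx' (seg_cat s2P eyh' (seg1 _ _)))
    (seg_cat (mc_t M) eby' s3P)).
  rewrite sE; count_perm.
- apply: (mc_grow M lP ul lst (seg_cat s1P exh (seg_cat lP _
    (seg_cat (seg_rev e_sym s2P) ex'y' s3P))) (mc_t M)); first by rewrite e_sym.
  rewrite sE; count_perm.
Qed.

Lemma mc_attach_same u v a b s t x y h h' :
  maxcov u v a b s t -> x \in s -> y \in s ->
  h \notin s ++ t -> h' \notin s ++ t -> e x h -> e y h' -> x = y.
Proof.
move=> M xs ys hst h'st exh eyh'; apply/eqP; apply: contraT => xy.
have xa : x != a by apply: contraTneq exh => ->; apply: mc_end M hst.
have ya : y != a by apply: contraTneq eyh' => ->; apply: mc_end M h'st.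
have [s1 [s2 [x' [sE s1P exx' s2P]]]] := seg_after (mc_s M) xs xa.
move: ys; rewrite sE mem_cat => /orP[ys|ys].
  rewrite eq_sym in xy; have [s3 [s4 [y' [s1E s3P eyy' s4P]]]] := seg_after s1P ys xy.
  rewrite s1E -catA in sE.
  by case: (mc_attach_ordered M sE s3P eyy' s4P exx' s2P h'st hst eyh' exh).
have [s3 [s4 [y' [s2E s3P eyy' s4P]]]] := seg_after s2P ys ya.
rewrite s2E in sE.
by case: (mc_attach_ordered M sE s1P exx' s3P eyy' s4P hst h'st exh eyh').
Qed.

(** If [x] had a predecessor [o], then [h], [a], [o] and the successor [y'] of [y] would be
    independent. The edge [oy'] exchanges tails: the first path continues behind [y], the second
    goes from [y] through uncovered vertices to [x] and its tail. For the swapped pair the same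
    argument gives [y = v]. *)
Lemma mc_attach_both u v a b s t x y h h' :
  maxcov u v a b s t -> x \in s -> y \in t ->
  h \notin s ++ t -> h' \notin s ++ t -> e x h -> e y h' -> x = u.
Proof.
move=> M xs yt hst h'st exh eyh'; have M' := maxcov_swap M.
apply/eqP; apply: contraT => xu; exfalso.
have yb : y != b.
  by apply: contraTneq eyh' => ->; apply: mc_end M' _; rewrite out_swap.
have [s1 [s2 [o [sE s1P eox s2P]]]] := seg_before (mc_s M) xs xu.
have [t1 [t2 [y' [tE t1P eyy' t2P]]]] := seg_after (mc_t M) yt yb.
have [l [lP ul lst]] := mc_link M hst h'st.
have os1 := seg_last s1P; have as2 := seg_last s2P; have y't2 := seg_head t2P.
have os : o \in s by rewrite sE mem_cat os1.
have as_ : a \in s by rewrite sE mem_cat as2 orbT.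
have y't : y' \in t by rewrite tE mem_cat y't2 orbT.
have ao : a != o.
  rewrite eq_sym; have := mc_uniq M; rewrite sE -catA => us.
  by apply: (uniq_cat_neq us os1); rewrite mem_cat as2.
have sy z : z \in s -> z != y' by move=> zs; apply: uniq_cat_neq (mc_uniq M) zs y't.
have st z : z \in s -> z \in s ++ t by rewrite mem_cat => ->.
have y'st : y' \in s ++ t by rewrite mem_cat y't orbT.
have := @free_4K1_edge _ e e_sym e_irr h a o y' free.
rewrite /= !inE !negb_or ao !(sy a, sy o) // !(mc_out_neq hst) ?(st _ as_) ?(st _ os) //.
move/(_ isT); rewrite e_sym (negPf (mc_end M _)) //=.
case/or4P=> [eho|ehy'|eao|/orP[eay'|eoy']].
- rewrite e_sym in eho; rewrite e_sym in exh.
  apply: (mc_grow1 M hst (seg_cat s1P eho (seg_cat (seg1 _ _) exh s2P)) (mc_t M)).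
  rewrite sE; count_perm.
- apply: (mc_grow M lP ul lst (mc_s M) (seg_cat t1P eyh'
    (seg_cat (seg_rev e_sym lP) ehy' t2P))).
  rewrite tE; count_perm.
- apply: (mc_grow1 M hst (seg_cat s1P _ (seg_cat (seg_rev e_sym s2P) exh
    (seg1 _ _))) (mc_t M)); first by rewrite e_sym.
  rewrite sE; count_perm.
- apply: (mc_grow1 M h'st (seg_cat (mc_s M) eay' t2P)
    (seg_cat t1P eyh' (seg1 _ _))).
  rewrite tE; count_perm.
- apply: (mc_grow M lP ul lst (seg_cat s1P eoy' t2P) (seg_cat t1P eyh'
    (seg_cat (seg_rev e_sym lP) _ s2P))); first by rewrite e_sym.
  rewrite sE tE; count_perm.
Qed.

End Maximal.

(** * Uncovered vertices attached to u and v *)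

Section CaseA.

Variables (T : finType) (e : rel T) (e_sym : symmetric e) (e_irr : irreflexive e).
Hypotheses (free : free_4K1 e) (e_conn : connected e [set: T]).
Implicit Types (x y z w h u v a b : T) (s t l p q : seq T).

Local Notation linked A := (connect (induced e A)).

Lemma clique_start p x :
  clique e p -> uniq p -> x \in p -> exists y p', seg e x y p' /\ perm_eq p' p.
Proof.
move=> cp up xp; have px := perm_to_rem xp.
exists (last x (rem x p)), (x :: rem x p); split; last by rewrite perm_sym.
apply: seg_path => //; apply: clique_path; last by rewrite -(perm_uniq px).
exact: clique_perm px cp.
Qed.

Lemma card_gt2 (A : {set T}) x y z :
  x \in A -> y \in A -> z \in A -> uniq [:: x; y; z] -> 2 < #|A|.
Proof.
move=> xA yA zA /card_uniqP cE; rewrite -[3]/(size [:: x; y; z]) -cE.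
apply/subset_leq_card/subsetP=> w.
by rewrite !inE => /or3P[]/eqP->.
Qed.

(* As h' is an uncovered neighbour of v, the v-path may be replaced by v h',
   which frees the vertices of q for the u-path. *)
Section Side.

Variables (u v a b h h' v' : T) (s q : seq T).
Hypotheses (M : maxcov e u v a b s (v :: q)) (qP : seg e v' b q) (vv' : e v v').
Hypotheses (hst : h \notin s ++ v :: q) (h'st : h' \notin s ++ v :: q).
Hypothesis vh' : e v h'.

Lemma side_uniq : uniq q.
Proof. by have := mc_uniq M; rewrite cat_uniq /= => /and4P[]. Qed.

Lemma side_out_adj z g : z \in q -> g \notin s ++ v :: q -> ~~ e z g.
Proof.
move=> zq gst; apply/negP=> ezg; have M' := maxcov_swap M.
have zvq : z \in v :: q by rewrite inE zq orbT.
move: (gst) (h'st); rewrite !(out_swap s) => gts h'ts.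
have zv := mc_attach_same e_sym e_irr free e_conn M' zvq (mem_head v q)
  gts h'ts ezg vh'.
move: zq; rewrite zv => vq.
by have := mc_uniq M; rewrite cat_uniq /= vq !andbF.
Qed.

(** For [z = v'] the first path would run on through all of [q] while [v] takes [h']. Then [h], [a],
    [v'], [b] force the edge [v'b] (unless [v' = b]), so [q] closes to a cycle and can be entered at
    any [z]. *)
Lemma side_end_adj z : z \in q -> ~~ e a z.
Proof.
move=> zq; have ab := mc_ends e_sym e_conn M hst; have M' := maxcov_swap M.
have as_ := seg_last (mc_s M); have v'q := seg_head qP; have bq := seg_last qP.
have av' : ~~ e a v'.
  apply/negP=> eav'; apply: (mc_grow1 M h'st (seg_cat (mc_s M) eav' qP)
    (seg_cat (seg1 _ _) vh' (seg1 _ _))); count_perm.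
have v'b : v' = b \/ e v' b.
  have [->|v'b] := eqVneq v' b; [by left | right; apply: contraT => ev'b].
  have ne x y : x \in s -> y \in q -> x != y.
    by move=> xs yq; apply: (uniq_cat_neq (mc_uniq M)); rewrite // inE yq orbT.
  have nh x : x \in s ++ q -> h != x.
    move=> xsq; apply: (mc_out_neq hst); move: xsq; rewrite !mem_cat inE.
    by case/orP=> ->; rewrite ?orbT.
  have := @free_4K1_edge _ e e_sym e_irr h a v' b free.
  rewrite /= !inE !negb_or v'b !(ne a) // !nh ?mem_cat ?as_ ?v'q ?bq ?orbT //.
  move/(_ isT); rewrite !(e_sym h) (negPf (mc_end M hst)) (negPf ab) (negPf av').
  by rewrite (negPf ev'b) !(negPf (side_out_adj _ hst)).
have [y' [q' [q'P q'q]]] := seg_rotate e_sym qP side_uniq v'b zq.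
apply/negP=> eaz; apply: (mc_grow1 M h'st (seg_cat (mc_s M) eaz q'P)
  (seg_cat (seg1 _ _) vh' (seg1 _ _))).
apply: (@perm_trans _ ((s ++ q) ++ [:: v; h'])); last by count_perm.
by rewrite perm_cat2r perm_cat2l.
Qed.

(** Neither [h] nor [a] has a neighbour in [q], so two non-adjacent vertices of [q] would complete
    them to four independent vertices. *)
Lemma side_clique : clique e q.
Proof.
move=> y z yq zq yz; have as_ := seg_last (mc_s M).
have ne x y' : x \in s -> y' \in q -> x != y'.
  by move=> xs y'q; apply: (uniq_cat_neq (mc_uniq M)); rewrite // inE y'q orbT.
have nh x : x \in s ++ q -> h != x.
  move=> xsq; apply: (mc_out_neq hst); move: xsq; rewrite !mem_cat inE.
  by case/orP=> ->; rewrite ?orbT.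
have := @free_4K1_edge _ e e_sym e_irr h a y z free.
rewrite /= !inE !negb_or yz !(ne a) // !nh ?mem_cat ?as_ ?yq ?zq ?orbT //.
move/(_ isT); rewrite !(e_sym h) (negPf (mc_end M hst)).
by rewrite !(negPf (side_out_adj _ hst)) // !(negPf (side_end_adj _)).
Qed.

Variables (p : seq T) (sE : s = u :: p) (p_clique : clique e p).

Lemma side_uniq_p : uniq p.
Proof. by have := mc_uniq M; rewrite sE cat_uniq /= => /andP[/andP[_ ->]]. Qed.

(** As both tails are cliques, [u] could enter [p] at [w], traverse all of it, leave at [x] and
    sweep [q], while [v] takes [h']. The next lemma exchanges the order of [p] and [q]. *)
Lemma side_cross_near w x y : w \in p -> x \in p -> y \in q ->
  e u w -> e x y -> w = x.
Proof.
move=> wp xp yq uw xy; apply/eqP; apply: contraT => wx; exfalso.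
have [l lP lp] := clique_seg p_clique side_uniq_p wp xp wx.
have [z [q' [q'P q'q]]] := clique_start side_clique side_uniq yq.
apply: (mc_grow1 M h'st (seg_cat (seg1 _ _) uw (seg_cat lP xy q'P))
  (seg_cat (seg1 _ _) vh' (seg1 _ _))); rewrite sE.
apply: (@perm_trans _ ((u :: p ++ q) ++ [:: v; h'])); last by count_perm.
by rewrite perm_cat2r perm_cons perm_cat.
Qed.

Lemma side_cross_far w x y : w \in q -> x \in p -> y \in q ->
  e u w -> e x y -> w = y.
Proof.
move=> wq xp yq uw xy; apply/eqP; apply: contraT => wy; exfalso.
rewrite e_sym in xy.
have [l lP lq] := clique_seg side_clique side_uniq wq yq wy.
have [z [p' [p'P p'p]]] := clique_start p_clique side_uniq_p xp.
apply: (mc_grow1 M h'st (seg_cat (seg1 _ _) uw (seg_cat lP xy p'P))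
  (seg_cat (seg1 _ _) vh' (seg1 _ _))); rewrite sE.
apply: (@perm_trans _ ((u :: q ++ p) ++ [:: v; h'])); last by count_perm.
by rewrite perm_cat2r perm_cons perm_cat.
Qed.

End Side.

(** The tails behind [u] and [v] are cliques without edges to uncovered vertices; whether an edge
    joins the two tails decides between (c) and (d). *)
Lemma no_attach_uv u v a b h h' s t :
  maxcov e u v a b s t -> h \notin s ++ t -> h' \notin s ++ t ->
  e u h -> e v h' -> cond_c e u v -> cond_d e u v -> False.
Proof.
move=> M hst h'st uh vh' Hc Hd; have M' := maxcov_swap M.
have au : a != u by apply: contraTneq uh => <-; apply: mc_end M hst.
have bv : b != v.
  by apply: contraTneq vh' => <-; apply: mc_end M' _; rewrite out_swap.
have [u' [p [sE uu' pP]]] := seg_behead (mc_s M) au.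
have [v' [q [tE vv' qP]]] := seg_behead (mc_t M) bv.
rewrite {}sE {}tE in M M' hst h'st.
have hts : h \notin (v :: q) ++ u :: p by rewrite out_swap.
have h'ts : h' \notin (v :: q) ++ u :: p by rewrite out_swap.
have ust := mc_uniq M.
have [up vq] : u \notin p /\ v \notin q.
  by move: ust; rewrite cat_uniq /= => /and3P[/andP[-> _] _ /andP[-> _]].
have disj z : z \in u :: p -> z \notin v :: q.
  by move=> zp; apply/negP=> /(uniq_cat_neq ust zp); rewrite eqxx.
have /norP[uv uq] := disj u (mem_head u p).
have pq z : z \in p -> z \notin q.
  by move=> zp; have := disj z; rewrite !inE zp orbT negb_or => /(_ isT)/andP[].
have vp : v \notin p.
  by apply/negP=> vp; have := disj v; rewrite !inE vp eqxx orbT => /(_ isT).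
have cp := side_clique M' pP h'ts hts uh.
have cq := side_clique M qP hst h'st vh'.
have aq := side_end_adj M qP hst h'st vh'.
have bp := side_end_adj M' pP h'ts hts uh.
have out z : z \notin p -> z \notin q -> z != u -> z != v ->
    z \notin (u :: p) ++ v :: q.
  by move=> zp zq zu zv; rewrite mem_cat !inE !negb_or zu zp zv zq.
have outp z g : z \in p -> e z g -> g \in (u :: p) ++ v :: q.
  move=> zp ezg; apply: contraTT ezg => gst.
  by apply: (side_out_adj M' hts uh zp); rewrite out_swap.
have outq z g : z \in q -> e z g -> g \in (u :: p) ++ v :: q.
  by move=> zq; apply: contraTT => gst; apply: (side_out_adj M h'st vh' zq).
have u'p := seg_head pP; have v'q := seg_head qP.
have ap := seg_last pP; have bq := seg_last qP.
have hE : [/\ h \notin p, h \notin q, h != u & h != v].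
  by move: hst; rewrite mem_cat !inE !negb_or => /andP[/andP[-> ->] /andP[-> ->]].
case: hE => hp hq hu hv.
(* Without an edge between [p] and [q], removing [u] and [v] leaves [p], [q] and the uncovered
   vertices in different components, against (c). *)
have [x0 [y0 [x0p y0q exy0]]] : exists x y, [/\ x \in p, y \in q & e x y].
  case: (boolP [exists x in p, exists y in q, e x y]).
    by case/exists_inP=> x xp /exists_inP[y yq exy]; exists x, y.
  move=> /exists_inPn npq; have npq' x y : x \in p -> y \in q -> ~~ e x y.
    by move=> xp yq; apply: contra (npq x xp) => exy; apply/exists_inP; exists y.
  pose A := ~: [set u; v].
  have clp : closed_in e A [set z in p].
    move=> x y; rewrite !inE negb_or => xp /andP[yu yv] exy.
    have := outp x y xp exy; rewrite mem_cat !inE (negPf yu) (negPf yv) /=.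
    by case/orP=> // yq; rewrite (negPf (npq' x y xp yq)) in exy.
  have clq : closed_in e A [set z in q].
    move=> x y; rewrite !inE negb_or => xq /andP[yu yv] exy.
    have := outq x y xq exy; rewrite mem_cat !inE (negPf yu) (negPf yv) /=.
    by case/orP=> // yp; rewrite e_sym (negPf (npq' y x yp xq)) in exy.
  have u'A : u' \in A.
    rewrite !inE negb_or; apply/andP; split.
      by apply: contraNneq up => <-.
    by apply: contraNneq vp => <-.
  have v'A : v' \in A.
    rewrite !inE negb_or; apply/andP; split.
      by apply: contraNneq uq => <-.
    by apply: contraNneq vq => <-.
  have hA : h \in A by rewrite !inE negb_or hu.
  have l1 : ~~ linked A u' v'.
    apply/negP=> /(linked_closed clp).
    by rewrite !inE u'p (negPf (contraL (pq v') v'q)) => /(_ isT).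
  have l2 : ~~ linked A u' h.
    by apply/negP=> /(linked_closed clp); rewrite !inE u'p (negPf hp) => /(_ isT).
  have l3 : ~~ linked A v' h.
    by apply/negP=> /(linked_closed clq); rewrite !inE v'q (negPf hq) => /(_ isT).
  case: Hc; split; last exact: (card_components_ge3 u'A v'A hA l1 l2 l3).
  by apply/connectedPn; exists u', h.
have nearp := side_cross_near M qP hst h'st vh' erefl cp.
have x0u' := nearp _ _ _ u'p x0p y0q uu' exy0.
have y0v' : v' = y0.
  rewrite e_sym in exy0.
  exact: (side_cross_near M' pP h'ts hts uh erefl cq v'q y0q x0p vv' exy0).
rewrite -{}x0u' -{}y0v' {x0p y0q x0 y0} in exy0.
have ev'u' : e v' u' by rewrite e_sym.
(* Fed back into the crossing lemmas, the edge [u'v'] shows that [u'] is the only vertex of [p], and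
   [v'] the only one of [q], that can have neighbours outside its own tail. *)
have F1 w : w \in p -> e u w -> w = u' by move=> wp uw; apply: nearp uw exy0.
have F2 w : w \in q -> e u w -> w = v'.
  move=> wq uw.
  exact: (side_cross_far M qP hst h'st vh' erefl cp wq u'p v'q uw exy0).
have F3 w : w \in q -> e v w -> w = v'.
  move=> wq vw.
  exact: (side_cross_near M' pP h'ts hts uh erefl cq wq v'q u'p vw ev'u').
have F4 w : w \in p -> e v w -> w = u'.
  move=> wp vw.
  exact: (side_cross_far M' pP h'ts hts uh erefl cq wp v'q u'p vw ev'u').
have F5 x y : x \in p -> y \in q -> e x y -> x = u' /\ y = v'.
  move=> xp yq exy; split; first by rewrite (nearp _ _ _ u'p xp yq uu' exy).
  rewrite e_sym in exy.
  by rewrite (side_cross_near M' pP h'ts hts uh erefl cq v'q yq xp vv' exy).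
have au' : a != u' by apply: contraTneq exy0 => <-; apply: aq.
have bv' : b != v' by apply: contraTneq ev'u' => <-; apply: bp.
(* Condition (d) fails for [x := u'] and [y := v'], articulation points because [a != u'] and
   [b != v']. [J1] consists of [u], [v] and the uncovered vertices, so the [x'] demanded by (d)
   would be an uncovered neighbour of a tail. *)
pose Q1 := [set z | z \notin p]; pose J1 := [set z | (z \notin p) && (z \notin q)].
have uJ : u \in J1 by rewrite inE up.
have vJ : v \in J1 by rewrite inE vp.
have hJ : h \in J1 by rewrite inE hp.
have J1_linked (B : {set T}) z : J1 \subset B -> z \in J1 -> linked B u z.
  move=> /subsetP JB; have outu g : g \in J1 -> g != u -> g != v -> linked B u g.
    rewrite inE => /andP[gp gq] gu gv.
    apply: connect_trans (linked1 (JB _ uJ) (JB _ hJ) uh) _.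
    have [<-|hg] := eqVneq h g; first exact: connect0.
    apply: linked1; [exact: JB | by apply: JB; rewrite inE gp |].
    exact: (mc_out_edge e_sym e_irr free e_conn M hst (out g gp gq gu gv) hg).
  move=> zJ; have [->|zu] := eqVneq z u; first exact: connect0.
  have [->|zv] := eqVneq z v; last exact: outu.
  have h'E : [/\ h' \notin p, h' \notin q, h' != u & h' != v].
    move: h'st; rewrite mem_cat !inE !negb_or.
    by case/andP=> /andP[-> ->] /andP[-> ->].
  case: h'E => h'p h'q h'u h'v; have h'J : h' \in J1 by rewrite inE h'p.
  apply: connect_trans (outu h' h'J h'u h'v) _.
  by apply: linked1; rewrite ?JB // e_sym.
have JQ : J1 \subset Q1 by apply/subsetP=> z; rewrite !inE => /andP[].
have Q1_linked (B : {set T}) z : Q1 \subset B -> z \in Q1 -> linked B u z.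
  move=> QB zQ; have [zJ|zJ] := boolP (z \in J1).
    by apply: J1_linked zJ; apply: subset_trans QB.
  have zq : z \in q by move: zQ zJ; rewrite !inE => ->; rewrite negbK.
  have qB y : y \in q -> y \in B.
    by move=> yq; apply: (subsetP QB); rewrite inE; apply: contraL yq; apply: pq.
  apply: connect_trans (J1_linked B v (subset_trans JQ QB) vJ) _.
  have vB : v \in B by apply/(subsetP QB)/(subsetP JQ).
  apply: connect_trans (linked1 vB (qB _ v'q) vv') _.
  exact: clique_linked cq qB v'q zq.
have Q1_closed : closed_in e (~: [set u']) Q1.
  move=> x y; rewrite !inE => xp yu' exy; apply: contraNN yu' => yp; apply/eqP.
  have eyx : e y x by rewrite e_sym.
  have := outp y x yp eyx; rewrite mem_cat !inE (negPf xp) orbF.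
  case/or3P=> [/eqP xu|/eqP xv|xq]; first by apply: F1; rewrite // -xu.
    by apply: F4; rewrite // -xv.
  by case: (F5 y x yp xq eyx).
have J1_closed : closed_in e (Q1 :\ v') J1.
  move=> x y; rewrite !inE => /andP[xp xq] /andP[yv' yp] exy; rewrite yp /=.
  apply: contraNN yv' => yq; apply/eqP; have eyx : e y x by rewrite e_sym.
  have := outq y x yq eyx; rewrite mem_cat !inE (negPf xp) (negPf xq) !orbF.
  by case/orP=> /eqP xE; [apply: F2; rewrite // -xE | apply: F3; rewrite // -xE].
have u'u : u' != u by apply: contraNneq up => <-.
have v'u : v' != u by apply: contraNneq uq => <-.
have Q1_sub : Q1 \subset ~: [set u'].
  by apply/subsetP=> z; rewrite !inE; apply: contraNneq => ->.
have J1_sub : J1 \subset Q1 :\ v'.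
  apply/subsetP=> z; rewrite !inE => /andP[-> zq]; rewrite andbT.
  by apply: contraNneq zq => ->.
have uQ : u \in Q1 by rewrite inE.
case: (Hd u' Q1 v' J1) => //.
- exact/eqP.
- rewrite /articulation inE setTD; apply/connectedPn; exists u, a.
  rewrite !inE au' eq_sym u'u; split=> //; apply/negP=> /(linked_closed Q1_closed).
  by rewrite !inE up ap => /(_ isT).
- apply: (@card_components_le _ e e_sym _ [:: u; a]) => z; rewrite !inE => zu'.
  have [zp|zp] := boolP (z \in p); last first.
    by exists u; rewrite ?mem_head //; apply: Q1_linked; rewrite ?inE.
  exists a; rewrite ?inE ?eqxx ?orbT //.
  have [->|za] := eqVneq z a; first exact: connect0.
  by apply: linked1; rewrite ?inE //; apply: cp; rewrite // eq_sym.
- apply: (is_component Q1_sub uQ _ Q1_closed) => // z; exact: Q1_linked Q1_sub.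
- exact/eqP.
- rewrite /articulation inE (contraL (pq v') v'q); apply/connectedPn; exists u, b.
  rewrite !inE up bv' (contraL (pq b) bq) eq_sym v'u; split=> //.
  apply/negP=> /(linked_closed J1_closed).
  by rewrite !inE up uq bq andbF => /(_ isT).
- by apply: (is_component J1_sub uJ _ J1_closed) => // z; apply: J1_linked J1_sub.
- by apply: (card_gt2 uJ vJ hJ); rewrite /= !inE negb_or uv !(eq_sym _ h) hu hv.
- move=> w; rewrite inE => wp u'w; have [wq|wq] := boolP (w \in q).
    by right; case: (F5 u' w u'p wq u'w).
  by left; rewrite inE wp.
move=> x' [+ /eqP x'u /eqP x'v]; rewrite inE => /andP[x'p x'q].
have x'st := out x' x'p x'q x'u x'v.
by case=> [/(outp _ _ u'p)|/(outq _ _ v'q)]; apply/negP.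
Qed.

End CaseA.

(** * Uncovered vertices attached to u only *)

Section CaseB.

Variables (T : finType) (e : rel T) (e_sym : symmetric e) (e_irr : irreflexive e).
Hypothesis free : free_4K1 e.
Implicit Types (x y z w h u v a b : T) (s t l p q : seq T).

Local Notation linked A := (connect (induced e A)).

(** It suffices that the covered vertices other than [u] have a Hamiltonian path from [v], since [u]
    can take [h]. They induce no 3K_1 because [h] sees none of them. If they were disconnected, or
    became so without [v], the uncovered vertices would supply a third component of [G - u], against
    (a), or of [G - {u,v}], against (c). *)
Lemma no_attach_u u v a b h s t :
  maxcov e u v a b s t -> h \notin s ++ t -> e u h ->
  (forall z g, z \in s ++ t -> g \notin s ++ t -> e z g -> z = u) ->
  cond_a e u v -> cond_c e u v -> False.
Proof.
move=> M hst uh outu Ha Hc.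
have us := seg_head (mc_s M); have vt := seg_head (mc_t M).
have ust : u \in s ++ t by rewrite mem_cat us.
have vst : v \in s ++ t by rewrite mem_cat vt orbT.
have uv : u != v := uniq_cat_neq (mc_uniq M) us vt.
have hu : h != u := mc_out_neq hst ust.
have hv : h != v := mc_out_neq hst vst.
pose F := [set z in s ++ t | z != u].
have hF : h \notin F by rewrite inE (negPf hst).
have clF : closed_in e (~: [set u]) F.
  move=> x y; rewrite !inE => /andP[xst xu] yu exy; rewrite yu andbT.
  by apply: contraTT exy => yst; apply: contraNN xu => exy; rewrite (outu x y).
have sF : F \subset ~: [set u] by apply/subsetP=> z; rewrite !inE => /andP[].
have cF : connected e F.
  apply: contraT => /connectedPn[x [y [xF yF nxy]]].
  have nl z : z \in F -> ~~ linked (~: [set u]) z h.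
    by move=> zF; apply: contra hF => /(linked_closed clF); apply.
  have nxy' : ~~ linked (~: [set u]) x y.
    by apply: contra nxy; apply: linked_restrict.
  have hA : h \in ~: [set u] by rewrite !inE.
  have [] // := Ha u; last first.
    have [xA yA] := (subsetP sF _ xF, subsetP sF _ yF).
    exact: (card_components_ge3 xA yA hA nxy' (nl _ xF) (nl _ yF)).
  rewrite /articulation inE setTD; apply/connectedPn; exists x, h.
  by split=> //; [apply: (subsetP sF) | apply: nl].
have vF : v \in F by rewrite inE vst eq_sym.
have nav : ~~ articulation e F v.
  apply/negP=> /andP[_ /connectedPn[x [y [xF yF nxy]]]]; pose A := ~: [set u; v].
  have sFA : F :\ v \subset A.
    by apply/subsetP=> z; rewrite !inE negb_or => /and3P[-> _ ->].
  have clFA : closed_in e A (F :\ v).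
    move=> g k; rewrite !inE negb_or => /andP[_ gF] /andP[ku ->] egk /=.
    have := clF g k; rewrite !inE gF ku => /(_ isT isT egk) /andP[-> _] //.
  have hFv : h \notin F :\ v by rewrite !inE (negPf hst) andbF.
  have nl z : z \in F :\ v -> ~~ linked A z h.
    by move=> zF; apply: contra hFv => /(linked_closed clFA); apply.
  have nxy' : ~~ linked A x y by apply: contra nxy; apply: linked_restrict.
  have hA : h \in A by rewrite !inE negb_or hu.
  have xA := subsetP sFA _ xF; have yA := subsetP sFA _ yF.
  case: Hc; split; first by apply/connectedPn; exists x, h; rewrite nl.
  exact: (card_components_ge3 xA yA hA nxy' (nl _ xF) (nl _ yF)).
have F3 : free_3K1_on e F.
  move=> x y z; rewrite !inE => /andP[xst xu] /andP[yst yu] /andP[zst zu] uxyz.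
  have nh g : g \in s ++ t -> g != u -> ~~ e h g.
    by move=> gst; apply: contraNN => ehg; rewrite (outu g h) // e_sym.
  have := @free_4K1_edge _ e e_sym e_irr h x y z free.
  rewrite cons_uniq uxyz !inE !negb_or !(mc_out_neq hst) // !(negPf (nh _ _ _)) //.
  exact.
have [b' [t' [t'P ut' t'F]]] := hamiltonian_path_from e_sym F3 cF vF nav.
apply: (mc_grow1 M hst (seg_cat (seg1 _ _) uh (seg1 _ _)) t'P).
apply: uniq_perm.
- by rewrite /= !inE !negb_or !t'F (negPf hF) inE eqxx andbF eq_sym hu ut'.
- by rewrite /= hst (mc_uniq M).
move=> z; rewrite !inE t'F inE.
have [->|zu] := eqVneq z u; first by rewrite ust orbT.
by rewrite andbT.
Qed.

(* With {z, c} = {u, v} this would only hold for |C| = 2. *)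
Lemma clique_two_paths C u v z c :
  clique e C -> uniq C -> u \in C -> v \in C -> z \in C -> c \in C ->
  u != v -> z != c -> c \notin [:: u; v] ->
  exists m n, (seg e u z m /\ seg e v c n \/ seg e u c m /\ seg e v z n)
    /\ perm_eq (m ++ n) C.
Proof.
move=> cC uC uCin vC zC cCin uv zc; rewrite !inE negb_or => /andP[cu cv].
have cr x : clique e (rem x C) by move=> y g /mem_rem yC /mem_rem; apply: cC.
have [->|zu] := eqVneq z u.
  have [||||| n nP nC] := @clique_seg _ e (rem u C) v c.
  - exact: cr.
  - exact: rem_uniq.
  - by rewrite mem_rem_uniq // !inE eq_sym uv.
  - by rewrite mem_rem_uniq // !inE cu.
  - by rewrite eq_sym.
  exists [:: u], n; split; first by left; rewrite seg1.
  by rewrite (perm_trans _ (_ : perm_eq (u :: rem u C) C)) ?perm_cons // perm_sym perm_to_rem.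
have [->|zv] := eqVneq z v.
  have [||||| n nP nC] := @clique_seg _ e (rem v C) u c.
  - exact: cr.
  - exact: rem_uniq.
  - by rewrite mem_rem_uniq // !inE uv.
  - by rewrite mem_rem_uniq // !inE cv.
  - by rewrite eq_sym.
  exists n, [:: v]; split; first by right; rewrite seg1.
  rewrite perm_catC (perm_trans _ (_ : perm_eq (v :: rem v C) C)) ?perm_cons //.
  by rewrite perm_sym perm_to_rem.
have ur : uniq (rem u C) by rewrite rem_uniq.
have zr : z \in rem u C by rewrite mem_rem_uniq // !inE zu.
have [||||| n nP nC] := @clique_seg _ e (rem z (rem u C)) v c.
- by move=> y g /mem_rem yC /mem_rem; apply: cr.
- exact: rem_uniq.
- by rewrite mem_rem_uniq // !inE mem_rem_uniq // !inE eq_sym zv eq_sym uv.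
- by rewrite mem_rem_uniq // !inE mem_rem_uniq // !inE eq_sym zc cu.
- by rewrite eq_sym.
exists [:: u; z], n; split.
  left; split=> //; apply: seg_cat (seg1 _ _) _ (seg1 _ _).
  by apply: cC; rewrite // eq_sym.
rewrite perm_sym (perm_trans (perm_to_rem uCin)) // perm_cons.
by rewrite (perm_trans (perm_to_rem zr)) // perm_cons perm_sym.
Qed.

End CaseB.

(** * Uncovered vertices attached to an inner vertex *)

Section CaseB2.

Variables (T : finType) (e : rel T) (e_sym : symmetric e) (e_irr : irreflexive e).
Hypotheses (free : free_4K1 e) (e_conn : connected e [set: T]).
Implicit Types (y z c p q g r : T) (l m n : seq T).

Local Notation linked A := (connect (induced e A)).

Variables (u v a b o x w h : T) (s1 s2 t : seq T).
Local Notation s := (s1 ++ x :: s2).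
(** The covered vertices split into [C], which holds both starts, the attachment [x], and the tail
    [s2] behind it. *)
Local Notation C := (s1 ++ t).
Hypotheses (M : maxcov e u v a b s t).
Hypotheses (s1P : seg e u o s1) (ox : e o x) (xw : e x w) (s2P : seg e w a s2).
Hypotheses (hst : h \notin s ++ t) (xh : e x h).
Hypothesis outx :
  forall z g, z \in s ++ t -> g \notin s ++ t -> e z g -> z = x.

Let us1 : u \in s1 := seg_head s1P.
Let os1 : o \in s1 := seg_last s1P.
Let vt : v \in t := seg_head (mc_t M).
Let bt : b \in t := seg_last (mc_t M).
Let ws2 : w \in s2 := seg_head s2P.
Let as2 : a \in s2 := seg_last s2P.
Let uC : u \in C. Proof. by rewrite mem_cat us1. Qed.
Let oC : o \in C. Proof. by rewrite mem_cat os1. Qed.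
Let vC : v \in C. Proof. by rewrite mem_cat vt orbT. Qed.
Let bC : b \in C. Proof. by rewrite mem_cat bt orbT. Qed.

Let covE z : (z \in s ++ t) = [|| z \in C, z == x | z \in s2].
Proof.
rewrite !mem_cat inE.
by case: (z \in s1); case: (z \in t); case: (z == x); case: (z \in s2).
Qed.

Let uniqs : [/\ uniq C, uniq s2, x \notin C, x \notin s2
  & forall z, z \in s2 -> z \notin C].
Proof.
have: uniq (x :: s2 ++ C).
  rewrite (perm_uniq (_ : perm_eq _ (s ++ t))) ?(mc_uniq M) //; count_perm.
rewrite /= mem_cat negb_or cat_uniq => /and3P[/andP[-> ->] -> /andP[/hasPn nC ->]].
by split=> // z; apply: contraTN => /nC.
Qed.

Let uniqC : uniq C. Proof. by case: uniqs. Qed.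
Let uniqs2 : uniq s2. Proof. by case: uniqs. Qed.
Let xC : x \notin C. Proof. by case: uniqs. Qed.
Let xs2 : x \notin s2. Proof. by case: uniqs. Qed.
Let s2C z : z \in s2 -> z \notin C. Proof. by case: uniqs => _ _ _ _; apply. Qed.
Let Cx z : z \in C -> z != x. Proof. by apply: contraTneq => ->. Qed.
Let s2x z : z \in s2 -> z != x. Proof. by apply: contraTneq => ->. Qed.
Let Cst z : z \in C -> z \in s ++ t. Proof. by rewrite covE => ->. Qed.
Let s2st z : z \in s2 -> z \in s ++ t. Proof. by rewrite covE => ->; rewrite !orbT. Qed.
Let neC z y : z \in s2 -> y \in C -> z != y.
Proof. by move=> zs yC; apply: contraNneq (s2C zs) => ->. Qed.
Let uv : u != v.
Proof. by apply: uniq_cat_neq uniqC us1 vt. Qed.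

Let out_adj z : z \in s ++ t -> z != x -> ~~ e h z.
Proof.
by move=> zst; apply: contraNN => ehz; rewrite (outx zst hst) // e_sym.
Qed.
Let ab : ~~ e a b := mc_ends e_sym e_conn M hst.

Let free_h c1 c2 c3 : c1 \in s ++ t -> c2 \in s ++ t -> c3 \in s ++ t ->
  x \notin [:: c1; c2; c3] -> uniq [:: c1; c2; c3] ->
  [|| e c1 c2, e c1 c3 | e c2 c3].
Proof.
rewrite !inE !negb_or !(eq_sym x) => st1 st2 st3 /and3P[x1 x2 x3] u123.
have := @free_4K1_edge _ e e_sym e_irr h c1 c2 c3 free.
rewrite cons_uniq u123 !inE !negb_or !(mc_out_neq hst) // => /(_ isT).
by rewrite !(negPf (out_adj _ _)).
Qed.

(** The tail turned round runs from [a] out through [x] to [h], so a neighbour of [a] in [C] would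
    give access to all of it. *)
Let tail_seg : seg e a h (rev s2 ++ [:: x; h]).
Proof.
apply: seg_cat (seg_rev e_sym s2P) _ (seg_cat (seg1 e x) xh (seg1 e h)).
by rewrite e_sym.
Qed.

(** Otherwise [h], [a], [b], [o] are independent, since the edge [oa] would attach the turned tail
    to [s1]. *)
Let ob : e o b.
Proof.
have ao : ~~ e a o.
  apply/negP=> eao; rewrite e_sym in eao.
  apply: (mc_grow1 M hst (seg_cat s1P eao tail_seg) (mc_t M)); count_perm.
have := @free_h a b o (s2st as2) (Cst bC) (Cst oC).
rewrite /= !inE !negb_or !(eq_sym x) (s2x as2) (Cx bC) (Cx oC) !(neC as2) //=.
rewrite eq_sym (uniq_cat_neq uniqC os1 bt) => /(_ isT isT).
by rewrite (negPf ab) (negPf ao) /= e_sym.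
Qed.

(* Thanks to the edge ob, the vertices of C form a cycle through the virtual
   edge uv: some pair of paths from u and v covers C and has c as an end. *)
Let extend c y z l : c \in C -> seg e y z l -> e c y ->
  exists a' b' m n, [/\ seg e u a' m, seg e v b' n & perm_eq (m ++ n) (C ++ l)].
Proof.
rewrite mem_cat => /orP[cs1|ct] lP cy.
  have [co|co] := eqVneq c o.
    rewrite co in cy; exists z, b, (s1 ++ l), t; split; [|exact: mc_t M|].
      exact: seg_cat s1P cy lP.
    count_perm.
  have [l1 [l2 [c' [s1E l1P _ l2P]]]] := seg_after s1P cs1 co.
  exists z, c', (l1 ++ l), (t ++ rev l2); split; first exact: seg_cat l1P cy lP.
    by apply: seg_cat (mc_t M) _ (seg_rev e_sym l2P); rewrite e_sym ob.
  rewrite s1E; count_perm.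
have [cb|cb] := eqVneq c b.
  rewrite cb in cy; exists o, z, s1, (t ++ l); split; [by []| |].
    exact: seg_cat (mc_t M) cy lP.
  count_perm.
have [l1 [l2 [c' [tE l1P _ l2P]]]] := seg_after (mc_t M) ct cb.
exists c', z, (s1 ++ rev l2), (l1 ++ l); split.
- exact: seg_cat s1P ob (seg_rev e_sym l2P).
- exact: seg_cat l1P cy lP.
rewrite tE; count_perm.
Qed.

Let no_extend c y z l : c \in C -> seg e y z l -> e c y ->
  ~ perm_eq l (h :: x :: s2).
Proof.
move=> cC lP cy ll; have [a' [b' [m [n [mP nP mn]]]]] := extend cC lP cy.
apply: (mc_grow1 M hst mP nP); apply: (perm_trans mn).
apply: (@perm_trans _ (C ++ h :: x :: s2)); first by rewrite perm_cat2l.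
count_perm.
Qed.

Let end_adjC c : c \in C -> ~~ e a c.
Proof.
move=> cC; apply/negP=> eac; rewrite e_sym in eac.
apply: (no_extend cC tail_seg eac); count_perm.
Qed.

Let cliqueC : clique e C.
Proof.
move=> y z yC zC yz; have := @free_h a y z (s2st as2) (Cst yC) (Cst zC).
rewrite /= !inE !negb_or !(eq_sym x) (s2x as2) (Cx yC) (Cx zC) yz !neC // => /(_ isT isT).
by rewrite !(negPf (end_adjC _)).
Qed.

Let e_uv : e u v. Proof. exact: cliqueC. Qed.

Let adj_C y g : y \in C -> e y g -> [|| g \in C, g == x | g \in s2].
Proof.
move=> yC; rewrite -covE; apply: contraTT => gst; apply/negP=> eyg.
by move: (Cx yC); rewrite (outx (Cst yC) gst eyg) eqxx.
Qed.

Let adj_s2 y g : y \in s2 -> e y g -> [|| g \in C, g == x | g \in s2].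
Proof.
move=> ys; rewrite -covE; apply: contraTT => gst; apply/negP=> eyg.
by move: (s2x ys); rewrite (outx (s2st ys) gst eyg) eqxx.
Qed.

Let articulation_x : articulation e [set: T] x.
Proof.
rewrite /articulation inE setTD; apply/connectedPn; exists u, h.
have hx : h != x by apply: (mc_out_neq hst); rewrite covE eqxx orbT.
rewrite !inE Cx // hx; split=> //.
have cl : closed_in e (~: [set x]) [set z in C ++ s2].
  move=> y z; rewrite !inE !(mem_cat _ _ s2) => yst zx eyz.
  have: [|| z \in C, z == x | z \in s2].
    by case/orP: yst => [yC|ys]; [apply: adj_C eyz | apply: adj_s2 eyz].
  by rewrite (negPf zx).
apply/negP=> /(linked_closed cl); rewrite !inE !(mem_cat _ _ s2) uC => /(_ isT).
by move=> hC; have := hst; rewrite covE; case/orP: hC => ->; rewrite ?orbT.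
Qed.

(** Otherwise [C], [s2] and the uncovered vertices are separated by [x], yet [u] and [v] are
    adjacent in the clique [C], against (a). *)
Let exists_cross : cond_a e u v ->
  exists p c, [/\ p \in s2, c \in C & e p c].
Proof.
move=> Ha; case: (boolP [exists p in s2, exists c in C, e p c]).
  by case/exists_inP=> p ps /exists_inP[c cC pc]; exists p, c.
move=> /exists_inPn nsC; pose A := ~: [set x].
have nsC' p c : p \in s2 -> c \in C -> ~~ e p c.
  by move=> ps cC; apply: contra (nsC p ps) => pc; apply/exists_inP; exists c.
have hx : h != x by apply: (mc_out_neq hst); rewrite covE eqxx orbT.
have clC : closed_in e A [set z in C].
  move=> y z; rewrite !(inE, in_setC) => yC zx eyz; have := adj_C yC eyz.
  rewrite (negPf zx) => /orP[//|zs].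
  by have := nsC' z y zs yC; rewrite e_sym eyz.
have cls : closed_in e A [set z in s2].
  move=> y z; rewrite !(inE, in_setC) => ys zx eyz; have := adj_s2 ys eyz.
  rewrite (negPf zx) => /orP[zC|//].
  by have := nsC' y z ys zC; rewrite eyz.
have uA : u \in A by rewrite !inE Cx.
have vA : v \in A by rewrite !inE Cx.
have aA : a \in A by rewrite !inE s2x.
have hA : h \in A by rewrite !inE.
have hC : h \notin C by apply: contra hst; apply: Cst.
have hs : h \notin s2 by apply: contra hst; apply: s2st.
have ua : ~~ linked A u a.
  by apply/negP=> /(linked_closed clC); rewrite !inE uC (negPf (s2C as2)) => /(_ isT).
have uh : ~~ linked A u h.
  by apply/negP=> /(linked_closed clC); rewrite !inE uC (negPf hC) => /(_ isT).
have ah : ~~ linked A a h.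
  by apply/negP=> /(linked_closed cls); rewrite !inE as2 (negPf hs) => /(_ isT).
have [//|_ _ sep] := Ha x articulation_x.
  exact: (card_components_ge3 uA aA hA ua uh ah).
by case: (linked_not_separated uA (linked1 uA vA e_uv) sep).
Qed.

(** Forced by [h], [b], [w], [a]: with the edge [bw] the second path would take over [s2] and the
    first would end in [x], [h]. *)
Let cyclic_s2 : w = a \/ e w a.
Proof.
have [->|wa] := eqVneq w a; [by left | right].
have bw : ~~ e b w.
  apply/negP=> bw; apply: (mc_grow1 M hst
    (seg_cat s1P ox (seg_cat (seg1 _ _) xh (seg1 _ _)))
    (seg_cat (mc_t M) bw s2P)); count_perm.
have := @free_h b w a (Cst bC) (s2st ws2) (s2st as2).
rewrite /= !inE !negb_or !(eq_sym x) (s2x ws2) (s2x as2) (Cx bC) wa !(eq_sym b) !neC //.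
by move/(_ isT isT); rewrite (negPf bw) e_sym (negPf ab).
Qed.

(** The path ending in [z] would go on to [x] and [h], the one ending in [c] would take all of [s2],
    entered at [p] in its cyclic order. *)
Let no_two_ends z c p m n :
  c \in C -> p \in s2 -> e z x -> e p c ->
  seg e u z m /\ seg e v c n \/ seg e u c m /\ seg e v z n ->
  ~ perm_eq (m ++ n) C.
Proof.
move=> cC ps zx pc mnP mn; have xhP := seg_cat (seg1 e x) xh (seg1 e h).
have [y [l [lP ls]]] := seg_rotate e_sym s2P uniqs2 cyclic_s2 ps.
rewrite e_sym in pc.
have goal k : perm_eq k ((m ++ n) ++ l ++ [:: x; h]) -> perm_eq k (h :: s ++ t).
  move=> kP; apply: (perm_trans kP).
  apply: (@perm_trans _ (C ++ s2 ++ [:: x; h])); last by count_perm.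
  by apply: perm_cat; rewrite // perm_cat2r.
case: mnP => -[mP nP].
  apply: (mc_grow1 M hst (seg_cat mP zx xhP) (seg_cat nP pc lP)).
  apply: goal; count_perm.
apply: (mc_grow1 M hst (seg_cat mP pc lP) (seg_cat nP zx xhP)).
apply: goal; count_perm.
Qed.

(** For [z != c], the clique [C] splits into paths from [u] and [v] ending in [z] and [c] as soon as
    one of [z], [c] lies outside [{u,v}]. If they are [u] and [v] themselves, only two one-vertex
    paths are possible, which requires [C] to have no further vertex. *)
Let cross_constraint z c p : z \in C -> c \in C -> p \in s2 ->
  e z x -> e p c ->
  z = c \/ [/\ z \in [:: u; v], c \in [:: u; v]
    & has (fun g => g \notin [:: u; v]) C].
Proof.
move=> zC cC ps zx pc; have [->|zc] := eqVneq z c; [by left | right].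
have [cuv|cuv] := boolP (c \in [:: u; v]); last first.
  have [m [n [mnP mn]]] := clique_two_paths cliqueC uniqC uC vC zC cC uv zc cuv.
  by case: (no_two_ends cC ps zx pc mnP mn).
have [zuv|zuv] := boolP (z \in [:: u; v]); last first.
  rewrite eq_sym in zc.
  have [m [n [mnP mn]]] := clique_two_paths cliqueC uniqC uC vC cC zC uv zc zuv.
  have mnP' : seg e u z m /\ seg e v c n \/ seg e u c m /\ seg e v z n by tauto.
  by case: (no_two_ends cC ps zx pc mnP' mn).
split=> //; apply: contraT => /hasPn Cuv; exfalso.
have mn : perm_eq ([:: u] ++ [:: v]) C.
  apply: uniq_perm => // [|y]; first by rewrite /= inE uv.
  apply/idP/idP=> [|/Cuv]; last by rewrite negbK.
  by rewrite !inE => /orP[]/eqP->.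
apply: (no_two_ends cC ps zx pc _ mn).
move: zuv cuv zc; rewrite !inE => /orP[]/eqP-> /orP[]/eqP->; rewrite ?eqxx //.
  by left; rewrite !seg1.
by right; rewrite !seg1.
Qed.

(** As [o] is adjacent to [x], a vertex of [C] seen from [s2] is [o] itself, or it lies with [o] in
    [{u,v}] and [C] is larger; some vertex of [C] always escapes both. It serves as the fourth
    vertex in showing that [s2] is a clique. *)
Let isolated_c : exists2 c0, c0 \in C & forall p, p \in s2 -> ~~ e p c0.
Proof.
have key c0 : c0 \in C -> o != c0 ->
    ~~ [&& o \in [:: u; v], c0 \in [:: u; v]
         & has (fun g => g \notin [:: u; v]) C] ->
    exists2 c0, c0 \in C & forall p, p \in s2 -> ~~ e p c0.
  move=> c0C oc0 nuv; exists c0 => // p ps; apply: contraNN nuv => pc0.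
  have [/eqP|[-> -> ->] //] := cross_constraint oC c0C ps ox pc0.
  by rewrite (negPf oc0).
have [ouv|ouv] := boolP (o \in [:: u; v]); last first.
  apply: (key u) => //; last by rewrite (negPf ouv).
  by apply: contraNneq ouv => ->; rewrite mem_head.
have [hC|hC] := boolP (has (fun g => g \notin [:: u; v]) C).
  case/hasP: (hC) => g gC guv; apply: (key g) => //; last by rewrite (negPf guv) andbF.
  by apply: contraNneq guv => <-.
move: ouv; rewrite !inE => /orP[]/eqP oE.
  by apply: (key v) => //; rewrite ?oE // (negPf hC) !andbF.
by apply: (key u) => //; rewrite ?oE 1?eq_sym // (negPf hC) !andbF.
Qed.

Let clique_s2 : clique e s2.
Proof.
move=> y z ys zs yz; have [c0 c0C nc0] := isolated_c.
have := @free_h y z c0 (s2st ys) (s2st zs) (Cst c0C).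
rewrite /= !inE !negb_or !(eq_sym x) (s2x ys) (s2x zs) (Cx c0C) yz !neC // => /(_ isT isT).
by rewrite !(negPf (nc0 _ _)) // !orbF.
Qed.

(** Otherwise [C] is left through [p], the clique [s2] is traversed up to [q], and [x], [h] follow.
    With [q = w], only [w] in [s2] can have neighbours outside [s2]. *)
Let cross_unique q p c :
  q \in s2 -> e x q -> p \in s2 -> c \in C -> e p c -> q = p.
Proof.
move=> qs xq ps cC pc; apply/eqP; apply: contraT => qp; exfalso.
rewrite eq_sym in qp; have [l lP ls] := clique_seg clique_s2 uniqs2 ps qs qp.
rewrite e_sym in pc; rewrite e_sym in xq.
apply: (no_extend cC (seg_cat lP xq (seg_cat (seg1 _ _) xh (seg1 _ _))) pc).
rewrite perm_catC /=.
by apply: (@perm_trans _ (x :: h :: s2)); [rewrite !perm_cons | count_perm].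
Qed.

(** The edges from [x] and [w] to [C] either all meet [C] in one vertex [r], and [x], [w], [r]
    violate (b), or they meet it only in [u] and [v] while [C] is larger, which violates (d). *)
Lemma no_attach_inner : cond_a e u v -> cond_b e u v -> cond_d e u v -> False.
Proof.
move=> Ha Hb Hd; have [p0 [c1 [p0s c1C p0c1]]] := exists_cross Ha.
have wE := cross_unique ws2 xw p0s c1C p0c1; rewrite -{}wE {p0 p0s} in p0c1.
have Mw p c : p \in s2 -> c \in C -> e p c -> p = w.
  by move=> ps cC pc; rewrite (cross_unique ws2 xw ps cC pc).
have Nw q : q \in s2 -> e x q -> q = w.
  by move=> qs xq; apply: cross_unique qs xq ws2 c1C p0c1.
have aw : a != w by apply: contraTneq p0c1 => <-; apply: end_adjC.
have hC : h \notin C by apply: contra hst; apply: Cst.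
have hs : h \notin s2 by apply: contra hst; apply: s2st.
have hx : h != x by apply: (mc_out_neq hst); rewrite covE eqxx orbT.
have wx := s2x ws2.
have wC := s2C ws2.
(* If the test succeeds, (d) fails for [x] and [y := w], with [Q1] made of [C] and [s2], and [J1]
   equal to [C]; the vertex [g] gives [J1] its third element. *)
case: (boolP [&& has (fun g => g \notin [:: u; v]) C,
    all (fun z => e z x ==> (z \in [:: u; v])) C
    & all (fun c => e w c ==> (c \in [:: u; v])) C]) => [|tight].
  case/and3P=> /hasP[g gC guv] /allP xuv /allP wuv.
  pose Q1 := [set z in C ++ s2]; pose J1 := [set z in C].
  have sCQ (B : {set T}) : Q1 \subset B -> {subset C <= B}.
    by move=> /subsetP QB y yC; apply: QB; rewrite inE mem_cat yC.
  have ssQ (B : {set T}) : Q1 \subset B -> {subset s2 <= B}.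
    by move=> /subsetP QB y ys; apply: QB; rewrite inE mem_cat ys orbT.
  have Q1_linked (B : {set T}) z : Q1 \subset B -> z \in Q1 -> linked B u z.
    move=> QB; rewrite inE mem_cat => /orP[zC|zs].
      exact: clique_linked cliqueC (sCQ B QB) uC zC.
    apply: connect_trans (clique_linked cliqueC (sCQ B QB) uC c1C) _.
    apply: connect_trans (clique_linked clique_s2 (ssQ B QB) ws2 zs).
    by apply: linked1; [apply: sCQ | apply: ssQ | rewrite e_sym].
  have Q1_closed : closed_in e (~: [set x]) Q1.
    move=> y z; rewrite !inE !(mem_cat _ _ s2) => yst zx eyz.
    have: [|| z \in C, z == x | z \in s2].
      by case/orP: yst => [yC|ys]; [apply: adj_C eyz | apply: adj_s2 eyz].
    by rewrite (negPf zx).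
  have J1_closed : closed_in e (Q1 :\ w) J1.
    move=> y z; rewrite !inE !(mem_cat _ _ s2) => yC /andP[zw zQ] eyz.
    case/orP: zQ => // zs; rewrite e_sym in eyz.
    by rewrite (Mw z y zs yC eyz) eqxx in zw.
  have Q1_sub : Q1 \subset ~: [set x].
    by apply/subsetP=> z; rewrite !inE mem_cat => /orP[]; [apply: Cx | apply: s2x].
  have J1_sub : J1 \subset Q1 :\ w.
    apply/subsetP=> z; rewrite !inE (mem_cat _ _ s2) => zC; rewrite zC andbT.
    by apply: contraTneq zC => ->.
  have uQ : u \in Q1 by rewrite inE mem_cat uC.
  have uJ : u \in J1 by rewrite inE.
  case: (Hd x Q1 w J1) => //.
  - by apply/eqP; rewrite eq_sym Cx.
  - apply: (@card_components_le _ e e_sym _ [:: u; h]) => z; rewrite !inE => zx.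
    have [zQ|zQ] := boolP (z \in Q1).
      by exists u; rewrite ?mem_head //; apply: Q1_linked.
    have zst : z \notin s ++ t.
      by move: zQ; rewrite covE inE (mem_cat _ _ s2) (negPf zx).
    exists h; first by rewrite !inE eqxx orbT.
    have [->|zh] := eqVneq z h; first exact: connect0.
    apply: linked1; rewrite ?inE //.
    by apply: (mc_out_edge e_sym e_irr free e_conn M hst zst); rewrite eq_sym.
  - by apply: (is_component Q1_sub uQ _ Q1_closed) => // z; apply: Q1_linked.
  - by apply/eqP/neC.
  - rewrite /articulation inE mem_cat ws2 orbT; apply/connectedPn; exists u, a.
    rewrite !inE !(mem_cat _ _ s2) uC as2 orbT aw eq_sym neC //; split=> //.
    apply/negP=> /(linked_closed J1_closed).
    by rewrite !inE uC (negPf (s2C as2)) => /(_ isT).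
  - apply: (is_component J1_sub uJ _ J1_closed) => // z; rewrite inE => zC.
    apply: clique_linked cliqueC _ uC zC => y yC.
    by apply: (subsetP J1_sub); rewrite inE.
  - by rewrite inE.
  - apply: (@card_gt2 _ _ u v g); rewrite ?inE //=.
    by move: guv; rewrite !inE !negb_or uv !(eq_sym g) => /andP[-> ->].
  - move=> z; rewrite !inE (mem_cat _ _ s2) => /orP[zC|zs] xz; [by left | right].
    exact: Nw.
  move=> x' [+ /eqP x'u /eqP x'v]; rewrite inE => x'C.
  case=> [xx'|wx'].
    have := xuv x' x'C; rewrite e_sym xx' !inE (negPf x'u) (negPf x'v) //.
  by have := wuv x' x'C; rewrite wx' !inE (negPf x'u) (negPf x'v).
(* Each way of failing the test yields a neighbour of [x] or [w] in [C] for which [cross_constraint]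
   leaves only equality; it is then adjacent to both and the only such neighbour of either. *)
have [r [rC rx wr xr_u wr_u]] : exists r, [/\ r \in C, e r x, e w r,
    forall z, z \in C -> e z x -> z = r & forall c, c \in C -> e w c -> c = r].
  have K z c : z \in C -> c \in C -> e z x -> e w c -> z = c \/ [/\ z \in [:: u; v],
      c \in [:: u; v] & has (fun g => g \notin [:: u; v]) C].
    by move=> zC cC zx wc; apply: cross_constraint zC cC ws2 zx wc.
  have pick r : r \in C -> e r x -> e w r ->
      ~~ ((r \in [:: u; v]) && has (fun g => g \notin [:: u; v]) C) ->
      exists r, [/\ r \in C, e r x, e w r,
        forall z, z \in C -> e z x -> z = r & forall c, c \in C -> e w c -> c = r].
    move=> rC rx wr nr; exists r; split=> // [z zC zx|c cC wc].
      by have [//|[_ ruv huv]] := K z r zC rC zx wr; rewrite ruv huv in nr.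
    by have [//|[ruv _ huv]] := K r c rC cC rx wc; rewrite ruv huv in nr.
  have oc1 := K o c1 oC c1C ox p0c1.
  move: tight; rewrite !negb_and => /or3P[nh|/allPn[z0 z0C]|/allPn[z0 z0C]].
  - have oE : o = c1 by case: oc1 => // -[_ _]; rewrite (negPf nh).
    by apply: (pick o) => //; rewrite ?(negPf nh) ?andbF // oE.
  - rewrite negb_imply => /andP[z0x z0uv].
    have z0E : z0 = c1.
      by have [//|[z0uv']] := K z0 c1 z0C c1C z0x p0c1; rewrite z0uv' in z0uv.
    by apply: (pick z0) => //; rewrite ?(negPf z0uv) // z0E.
  - rewrite negb_imply => /andP[wz0 z0uv].
    have z0E : o = z0.
      by have [//|[_ z0uv']] := K o z0 oC z0C ox wz0; rewrite z0uv' in z0uv.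
    by apply: (pick z0) => //; rewrite ?(negPf z0uv) // -z0E.
have rx' : r != x := Cx rC.
have wr' : w != r := neC ws2 rC.
have artw : articulation e [set: T] w.
  rewrite /articulation inE setTD; apply/connectedPn; exists a, x.
  rewrite !inE aw eq_sym wx; split=> //.
  have cl : closed_in e (~: [set w]) [set z in s2 | z != w].
    move=> y z; rewrite !inE => /andP[ys yw] zw eyz; rewrite zw andbT.
    case/or3P: (adj_s2 ys eyz) => // [zC|/eqP zx].
      by rewrite (Mw y z ys zC eyz) eqxx in yw.
    by rewrite e_sym zx in eyz; rewrite (Nw y ys eyz) eqxx in yw.
  apply/negP=> /(linked_closed cl); rewrite !inE as2 aw (negPf xs2) => /(_ isT) //.
have artr : articulation e [set: T] r.
  rewrite /articulation inE setTD; apply/connectedPn.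
  have [g [gC gr]] : exists g, g \in C /\ g != r.
    have [ur|ur] := eqVneq u r; last by exists u.
    by exists v; rewrite vC -ur eq_sym.
  exists g, x; rewrite !inE gr eq_sym rx'; split=> //.
  have cl : closed_in e (~: [set r]) [set z in C | z != r].
    move=> y z; rewrite !(inE, in_setC) => /andP[yC yr] zr eyz; rewrite zr andbT.
    case/or3P: (adj_C yC eyz) => // [/eqP zx|zs].
      by rewrite zx in eyz; rewrite (xr_u y yC eyz) eqxx in yr.
    rewrite e_sym in eyz; have zw := Mw z y zs yC eyz.
    by rewrite zw in eyz; rewrite (wr_u y yC eyz) eqxx in yr.
  apply/negP=> /(linked_closed cl).
  by rewrite !(inE, in_setC) gC gr (negPf xC) => /(_ isT).
have xr : e x r by rewrite e_sym.
have [Hb1 Hb2] := Hb x w r articulation_x artw artr xw wr xr.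
pose S := [set x; w; r].
have SC z : z \in C -> (z \in S) = (z == r).
  move=> zC; rewrite !inE (negPf (Cx zC)) /=; case: eqVneq => // zw.
  by rewrite zw (negPf wC) in zC.
have e_vu : e v u by rewrite e_sym.
(* If [r] is one of [u], [v], the other is a neighbour of [r] outside the triangle, hence lies in a
   component adjacent to [r], against the second half of (b). *)
have one y z : y \in C -> z \in C -> y = r -> z != r -> e y z ->
    y = u /\ z = v \/ y = v /\ z = u -> False.
  move=> yC zC yr zr yz yzuv.
  have zS : z \in ~: S by rewrite in_setC SC.
  have [] := negP (Hb2 y z yzuv _ _ (comp_of e (~: S) z) (comp_of_in e zS) _).
  - by rewrite SC // yr.
  - by rewrite SC.
  - by apply/exists_inP; exists z; rewrite ?mem_comp_of.
  - exact: mem_comp_of.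
have [ur|ur] := eqVneq u r.
  by apply: (one u v) => //; [rewrite -ur eq_sym | left].
have [vr|vr] := eqVneq v r; first by apply: (one v u) => //; right.
have uS : u \in ~: S by rewrite in_setC SC.
have vS : v \in ~: S by rewrite in_setC SC.
apply: (linked_not_separated uS (linked1 uS vS e_uv)).
by apply: Hb1; rewrite SC.
Qed.

End CaseB2.

(** * Sufficiency *)

Section Symmetry.

Variables (T : finType) (e : rel T) (u v : T).

Lemma cond_a_sym : cond_a e u v -> cond_a e v u.
Proof.
move=> H x ax cx; have [ux vx sep] := H x ax cx; split=> // C CA [vC uC].
by apply: (sep C CA).
Qed.

Lemma cond_b_sym : cond_b e u v -> cond_b e v u.
Proof.
move=> H x y z ax ay az exy eyz exz S; have [H1 H2] := H x y z ax ay az exy eyz exz.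
split=> [vS uS C CA [vC uC]|w w' ww']; first by apply: (H1 uS vS C CA).
by apply: H2; case: ww'; [right | left].
Qed.

Lemma cond_c_sym : cond_c e u v -> cond_c e v u.
Proof. by rewrite /cond_c setUC. Qed.

(** The wording favours [u], but both vertices lie in [J1], hence both differ from [x] and [y] and
    determine the same components. *)
Lemma cond_d_sym : cond_d e u v -> cond_d e v u.
Proof.
move=> H x Q1 y J1 _ ax cx Q1C _ _ ay J1C vJ uJ J2 Nx.
have uQy := comp_sub J1C uJ; have /setD1P[/eqP uy uQ] := uQy.
have := comp_sub Q1C uQ; rewrite !inE => /eqP ux.
have ux' : x <> u by move=> xE; rewrite xE in ux.
have uy' : y <> u by move=> yE; rewrite yE in uy.
have [x' [x'J x'u x'v x'e]] := H x Q1 y J1 ux' ax cx Q1C uQ uy' ay J1C uJ vJ J2 Nx.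
by exists x'.
Qed.

End Symmetry.

Section Sufficiency.

Variables (T : finType) (e : rel T) (e_sym : symmetric e) (e_irr : irreflexive e).
Hypothesis free : free_4K1 e.
Implicit Types (x y z w h u v a b : T) (s t l : seq T).

Local Notation linked A := (connect (induced e A)).

(** A pair is encoded as one list with a cutting index, so that a maximum over single lists applies;
    [seg] rejects an empty half. *)
Lemma maxcov_exists u v : u != v -> exists a b s t, maxcov e u v a b s t.
Proof.
move=> uv.
pose P l := uniq l && [exists i : 'I_(size l).+1,
  seg e u (last u (take i l)) (take i l) && seg e v (last v (drop i l)) (drop i l)].
have Pcat a b s t : seg e u a s -> seg e v b t -> uniq (s ++ t) -> P (s ++ t).
  move=> sP tP ust; rewrite /P ust; apply/existsP.
  have si : size s < (size (s ++ t)).+1 by rewrite ltnS size_cat leq_addr.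
  exists (Ordinal si); rewrite take_size_cat // drop_size_cat //.
  case/segP: sP => p [-> ep _]; case/segP: tP => q [-> eq _].
  by rewrite !seg_path.
have P0 := Pcat _ _ _ _ (seg1 e u) (seg1 e v).
have Pu l : P l -> uniq l by case/andP.
rewrite /= inE uv in P0; have [l Pl lmax] := longest_seq (P0 isT) Pu.
case/andP: Pl => ul /existsP[i /andP[sP tP]].
exists (last u (take i l)), (last v (drop i l)), (take i l), (drop i l).
split; rewrite // ?cat_take_drop // => a' b' s' t' s'P t'P us'.
exact: lmax (Pcat _ _ _ _ s'P t'P us').
Qed.

Lemma segs_path_cover u v a b s t :
  seg e u a s -> seg e v b t -> uniq (s ++ t) -> (forall z, z \in s ++ t) ->
  path_cover e u v.
Proof. by move=> /segP[p [-> ep _]] /segP[q [-> eq _]] ust cov; exists p, q. Qed.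

Lemma connected_no_attach u v a b x h s t : connected e [set: T] ->
  maxcov e u v a b s t -> x \in s -> h \notin s ++ t -> e x h ->
  [/\ cond_a e u v, cond_b e u v, cond_c e u v & cond_d e u v] -> False.
Proof.
move=> cG M xs hst xh [Ha Hb Hc Hd]; have M' := maxcov_swap M.
case: (boolP [exists y in t, exists g, (g \notin s ++ t) && e y g]) => [|nt].
  case/exists_inP=> y yt /existsP[g /andP[gst yg]].
  have xu := mc_attach_both e_sym e_irr free cG M xs yt hst gst xh yg.
  have yv : y = v.
    apply: (mc_attach_both e_sym e_irr free cG M' yt xs _ _ yg xh);
      by rewrite out_swap.
  rewrite xu in xh; rewrite yv in yg.
  exact: (no_attach_uv e_sym e_irr free cG M hst gst xh yg Hc Hd).
have outx z g : z \in s ++ t -> g \notin s ++ t -> e z g -> z = x.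
  rewrite mem_cat => /orP[zs|zt] gst zg.
    exact: (mc_attach_same e_sym e_irr free cG M zs xs gst hst zg xh).
  case/exists_inP: nt; exists z => //; apply/existsP; exists g.
  by rewrite gst.
have [xu|xu] := eqVneq x u.
  rewrite xu in xh outx.
  exact: (no_attach_u e_sym e_irr free M hst xh outx Ha Hc).
have ax : a != x by apply: contraTneq xh => <-; apply: mc_end M hst.
have [s1 [s' [o [sE s1P ox s'P]]]] := seg_before (mc_s M) xs xu.
have [w [s2 [s'E xw s2P]]] := seg_behead s'P ax.
rewrite s'E in sE; rewrite sE in M hst outx.
exact: (no_attach_inner e_sym e_irr free cG M s1P ox xw s2P hst xh outx Ha Hb Hd).
Qed.

Lemma connected_path_cover u v : u != v -> connected e [set: T] ->
  [/\ cond_a e u v, cond_b e u v, cond_c e u v & cond_d e u v] ->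
  path_cover e u v.
Proof.
move=> uv cG H; have [a [b [s [t M]]]] := maxcov_exists uv.
apply: (segs_path_cover (mc_s M) (mc_t M) (mc_uniq M)) => h0.
apply: contraT => /(mc_touch cG M)[x [h [xst hst xh]]]; exfalso.
move: xst; rewrite mem_cat => /orP[xs|xt].
  exact: connected_no_attach cG M xs hst xh H.
case: H => Ha Hb Hc Hd; rewrite out_swap in hst.
apply: (connected_no_attach cG (maxcov_swap M) xt hst xh); split.
- exact: cond_a_sym.
- exact: cond_b_sym.
- exact: cond_c_sym.
- exact: cond_d_sym.
Qed.

(** * The disconnected case *)

Lemma comp_of_connected x : connected e (comp_of e [set: T] x).
Proof.
apply/connectedP=> y z; rewrite !inE /= => xy xz.
have yC : y \in comp_of e [set: T] x by rewrite !inE.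
have cl := comp_closed e_sym (comp_of_in e (in_setT x)).
apply: (linked_restrict (subsetT _) cl yC).
by rewrite (linked_sym e_sym) in xy; apply: connect_trans xy xz.
Qed.

(** A vertex of another component would complete three independent vertices to four. *)
Lemma comp_of_free_3K1 x y :
  ~~ linked [set: T] x y -> free_3K1_on e (comp_of e [set: T] x).
Proof.
move=> nxy c1 c2 c3 C1 C2 C3 u123.
have Cc := comp_of_in e (in_setT x).
have yC : y \notin comp_of e [set: T] x by rewrite !inE.
have ny c : c \in comp_of e [set: T] x -> (y != c) && ~~ e y c.
  move=> cC; rewrite (contraNneq _ yC) /=; last by move=> ->.
  by rewrite e_sym; apply: contra yC; apply: (comp_closed e_sym Cc cC).
have /andP[y1 n1] := ny c1 C1; have /andP[y2 n2] := ny c2 C2.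
have /andP[y3 n3] := ny c3 C3.
have := @free_4K1_edge _ e e_sym e_irr y c1 c2 c3 free.
rewrite cons_uniq u123 !inE !negb_or y1 y2 y3 (negPf n1) (negPf n2) (negPf n3).
exact.
Qed.

(** Each component has no 3K_1, as the other one is nonempty, so it has a Hamiltonian path from its
    own [u] or [v]. *)
Lemma disconnected_path_cover u v : cond_disconnected e u v -> path_cover e u v.
Proof.
case=> c2 sep art; pose A : {set T} := [set: T].
have nuv : ~~ linked A u v.
  by apply/negP=> uv; apply: (linked_not_separated (in_setT u) uv sep).
have nvu : ~~ linked A v u by rewrite (linked_sym e_sym).
have uA := comp_of_in e (in_setT u); have vA := comp_of_in e (in_setT v).
have uC := mem_comp_of e (in_setT u); have vC := mem_comp_of e (in_setT v).
have [artu _] := art _ uA; have [_ artv] := art _ vA.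
have [a [s [sP us sE]]] := hamiltonian_path_from e_sym (comp_of_free_3K1 nuv)
  (comp_of_connected u) uC (artu uC).
have [b [t [tP ut tE]]] := hamiltonian_path_from e_sym (comp_of_free_3K1 nvu)
  (comp_of_connected v) vC (artv vC).
apply: (segs_path_cover sP tP).
  rewrite cat_uniq us ut andbT; apply/hasPn=> z; rewrite tE sE !inE /= => vz.
  apply: contra nuv => uz; rewrite (linked_sym e_sym) in vz.
  exact: connect_trans uz vz.
move=> z; rewrite mem_cat sE tE !inE /=; apply: contraT.
rewrite negb_or => /andP[nuz nvz].
by have := card_components_ge3 (in_setT u) (in_setT v) (in_setT z) nuv nuz nvz; rewrite c2.
Qed.

End Sufficiency.

(** * Necessity *)

Lemma seg_exit (T : finType) (r : rel T) (C X : pred T) c d l :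
  seg r c d l -> c \in C -> d \notin C ->
  (forall y z, y \in C -> z \notin C -> r y z -> z \in X) ->
  exists2 z, z \in l & z \in X.
Proof.
case/segP=> p [->]; elim: p c => [|z p IHp] c /=; first by move=> _ -> ->.
move=> /andP[rcz rp] lp cC dC exitC; have [zC|zC] := boolP (z \in C).
  by have [y yl yX] := IHp z rp lp zC dC exitC; exists y => //; rewrite inE yl orbT.
by exists z; [rewrite !inE eqxx orbT | apply: exitC rcz].
Qed.

Section Necessity.

Variables (T : finType) (e : rel T) (e_sym : symmetric e) (e_irr : irreflexive e).
Implicit Types (x y z w h u v a b c : T) (s t l : seq T) (A B C : {set T}).

Local Notation linked A := (connect (induced e A)).

(** Without its first vertex, [s] is still a path, starting at [w]: one representative for counting
    components. For a one-vertex path the claim is vacuous. *)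
Lemma tail_linked A x y s :
  seg e x y s -> uniq s -> (forall z, z \in s -> z != x -> z \in A) ->
  exists w, forall z, z \in s -> z != x -> linked A w z.
Proof.
move=> sP us sA; have [yx|yx] := eqVneq y x.
  rewrite yx in sP; exists x => z; rewrite (seg_loop sP us) inE => /eqP->.
  by rewrite eqxx.
have [w [s' [sE xw s'P]]] := seg_behead sP yx; exists w => z.
rewrite sE inE => /predU1P[->|zs' _]; first by rewrite eqxx.
apply: (seg_linked s'P) zs' => g gs'; apply: sA; first by rewrite sE inE gs' orbT.
by apply: contraTneq gs' => ->; move: us; rewrite sE => /andP[].
Qed.

Record cover u v a b s t : Prop := Cover {
  cov_s : seg e u a s;
  cov_t : seg e v b t;
  cov_uniq : uniq (s ++ t);
  cov_all : forall z, z \in s ++ t }.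

Lemma path_cover_segs u v : path_cover e u v -> exists a b s t, cover u v a b s t.
Proof.
case=> p [q [ep eq us cov]]; exists (last u p), (last v q), (u :: p), (v :: q).
by split=> //; apply: seg_path.
Qed.

Lemma cover_swap u v a b s t : cover u v a b s t -> cover v u b a t s.
Proof.
case=> sP tP us cov; split; rewrite // ?(uniq_catC t) // => z.
by have := cov z; rewrite !mem_cat orbC.
Qed.

(** Removing [x] leaves at most three pieces: [s] before [x], [s] behind [x], and [t]. With three
    components the first cannot be missing, so [x] is not [u], nor can it be linked to [t]. *)
Lemma cover_cut_vertex u v a b s t x : cover u v a b s t -> x \in s ->
  3 <= #|components e (~: [set x])| ->
  [/\ u <> x, v <> x & ~~ linked (~: [set x]) u v].
Proof.
case=> sP tP ust cov xs c3; set A := ~: [set x] in c3 *.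
have us : uniq s by move: ust; rewrite cat_uniq => /and3P[].
have tx z : z \in t -> z != x.
  by move=> zt; rewrite eq_sym (uniq_cat_neq ust xs zt).
have tA : {subset t <= A} by move=> z /tx zx; rewrite !inE.
have tl z : z \in t -> linked A v z := seg_linked tP tA.
have two y1 y2 : ~ (forall z, z \in A -> exists2 y, y \in [:: y1; y2] & linked A y z).
  by move/(card_components_le e_sym); rewrite leqNgt c3.
have xu : x != u.
  apply/eqP=> xu; rewrite -xu in sP.
  have [|w wl] := tail_linked (A := A) sP us.
    by move=> z _; rewrite !inE.
  case: (two w v) => z; rewrite !inE => zx; have := cov z; rewrite mem_cat.
  case/orP=> [zs|zt]; first by exists w; rewrite ?inE ?eqxx //; apply: wl.
  by exists v; rewrite ?inE ?eqxx ?orbT //; apply: tl.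
split.
- by apply/eqP; rewrite eq_sym.
- by apply/eqP/tx/(seg_head tP).
apply/negP=> uv; have [s1 [s2 [o [sE s1P _ s2P]]]] := seg_before sP xs xu.
have us12 : uniq (s1 ++ s2) by rewrite -sE.
have us2 : uniq s2 by move: us12; rewrite cat_uniq => /and3P[].
have [|w wl] := tail_linked (A := A) s2P us2.
  by move=> z _; rewrite !inE.
have s1A : {subset s1 <= A}.
  by move=> z zs1; rewrite !inE (uniq_cat_neq us12 zs1 (seg_head s2P)).
case: (two u w) => z; rewrite !inE => zx; have := cov z; rewrite sE !mem_cat.
case/orP=> [/orP[zs1|zs2]|zt].
- by exists u; rewrite ?inE ?eqxx //; apply: seg_linked s1P s1A zs1.
- by exists w; rewrite ?inE ?eqxx ?orbT //; apply: wl.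
by exists u; rewrite ?inE ?eqxx //; apply: connect_trans uv (tl z zt).
Qed.

Lemma path_cover_cond_a u v : path_cover e u v -> cond_a e u v.
Proof.
case/path_cover_segs=> a [b [s [t M]]] x _ c3.
suff [ux vx nuv] : [/\ u <> x, v <> x & ~~ linked (~: [set x]) u v].
  by split=> //; apply: separatedPn.
have := cov_all M x; rewrite mem_cat => /orP[xs|xt].
  exact: cover_cut_vertex M xs c3.
have [vx ux nvu] := cover_cut_vertex (cover_swap M) xt c3.
by split=> //; rewrite (linked_sym e_sym).
Qed.

Lemma path_cover_cond_c u v : path_cover e u v -> cond_c e u v.
Proof.
case/path_cover_segs=> a [b [s [t [sP tP ust cov]]]] [_ c3].
have us : uniq s by move: ust; rewrite cat_uniq => /and3P[].
have ut : uniq t by move: ust; rewrite cat_uniq => /and3P[].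
have neq z y : z \in s -> y \in t -> z != y := uniq_cat_neq ust.
have su z : z \in s -> z != v by move=> zs; apply: neq (seg_head tP).
have tu z : z \in t -> z != u.
  by move=> zt; rewrite eq_sym; apply: neq (seg_head sP) zt.
have [|w1 w1l] := tail_linked (A := ~: [set u; v]) sP us.
  by move=> z zs zu; rewrite !inE negb_or zu su.
have [|w2 w2l] := tail_linked (A := ~: [set u; v]) tP ut.
  by move=> z zt zv; rewrite !inE negb_or zv tu.
suff: #|components e (~: [set u; v])| <= 2 by rewrite leqNgt c3.
apply: (@card_components_le _ e e_sym _ [:: w1; w2]) => z; rewrite !inE negb_or => /andP[zu zv].
have := cov z; rewrite mem_cat => /orP[zs|zt].
  by exists w1; rewrite ?inE ?eqxx //; apply: w1l.
by exists w2; rewrite ?inE ?eqxx ?orbT //; apply: w2l.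
Qed.

(** * Sets attached at a single vertex *)

Definition pendant (r : rel T) C x :=
  x \notin C /\ forall y z, y \in C -> z \notin C -> r y z -> z = x.

(* A path containing all vertices that enters C through x cannot leave it. *)
Lemma pendant_end (r : rel T) (r_sym : symmetric r) C x c a b l :
  seg r a b l -> uniq l -> (forall z, z \in l) -> pendant r C x -> c \in C ->
  (a \in C) || (b \in C).
Proof.
move=> lP ul cov [xC exitC] cC; apply: contraT; rewrite negb_or => /andP[aC bC].
have ca : c != a by apply: contraNneq aC => <-.
have [l1 [l2 [o [lE l1P roc l2P]]]] := seg_before lP (cov c) ca.
have exit1 y z : y \in C -> z \notin C -> r y z -> z \in pred1 x.
  by move=> yC zC ryz; apply/eqP; apply: exitC ryz.
have [z zl2 /eqP zx] := seg_exit l2P cC bC exit1.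
have rco : r c o by rewrite r_sym.
have [y + /eqP yx] := seg_exit (seg_cat (seg1 r c) rco (seg_rev r_sym l1P)) cC aC exit1.
rewrite zx in zl2; rewrite yx mem_cat mem_rev inE => /orP[/eqP xc|xl1].
  by rewrite xc cC in xC.
by rewrite lE in ul; have := uniq_cat_neq ul xl1 zl2; rewrite eqxx.
Qed.

Definition add_edge u v : rel T :=
  [rel y z | [|| e y z, (y == u) && (z == v) | (y == v) && (z == u)]].

Lemma add_edge_sym u v : symmetric (add_edge u v).
Proof.
move=> y z; rewrite /add_edge /= e_sym; congr (_ || _); rewrite orbC.
by rewrite ![_ && (y == _)]andbC.
Qed.

Lemma pendant_add_edge u v C x : pendant e C x ->
  (u \in C -> v \in C \/ v = x) -> (v \in C -> u \in C \/ u = x) ->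
  pendant (add_edge u v) C x.
Proof.
move=> [xC exitC] uC vC; split=> // y z yC zC /or3P[|/andP[/eqP yu /eqP zv]|].
- exact: exitC.
- by rewrite yu in yC; rewrite zv in zC *; case: (uC yC) => // vC'; rewrite vC' in zC.
case/andP=> /eqP yv /eqP zu.
by rewrite yv in yC; rewrite zu in zC *; case: (vC yC) => // uC'; rewrite uC' in zC.
Qed.

(** With the edge [uv], [rev s ++ t] is a Hamiltonian path from [a] to [b]. The two implications say
    that this edge opens no second exit from [C]. *)
Lemma cover_pendant u v a b s t C x c : cover u v a b s t ->
  pendant e C x -> (u \in C -> v \in C \/ v = x) ->
  (v \in C -> u \in C \/ u = x) -> c \in C -> (a \in C) || (b \in C).
Proof.
case=> sP tP us cov pC uC vC cC.
have sub y z l : seg e y z l -> seg (add_edge u v) y z l.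
  case/segP=> p [-> ep lp]; apply: seg_path lp; apply: sub_path ep => g k.
  by rewrite /add_edge /= => ->.
have uv : add_edge u v u v by rewrite /add_edge /= !eqxx orbT.
have lP := seg_cat (seg_rev (@add_edge_sym u v) (sub _ _ _ sP)) uv (sub _ _ _ tP).
apply: (pendant_end (@add_edge_sym u v) lP _ _ (pendant_add_edge pC uC vC) cC).
  by rewrite (perm_uniq (_ : perm_eq _ (s ++ t))) // perm_cat2r perm_rev.
by move=> z; have := cov z; rewrite !mem_cat mem_rev.
Qed.

Lemma pendant_linked A C x y z :
  pendant e C x -> x \notin A -> linked A y z -> y \in C -> z \in C.
Proof.
move=> [xC exitC] xA; apply: linked_closed => g k gC kA gk.
by apply: contraT => kC; rewrite (exitC g k gC kC gk) in kA; rewrite kA in xA.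
Qed.

(** The union of the components of [G - x] that miss [y]. For a triangle through [x] and [y], it is
    what hangs at [x] away from the triangle. *)
Definition cut_side x y : {set T} :=
  [set w | (w != x) && ~~ linked ([set: T] :\ x) y w].

Lemma cut_side_ref x y z : z != x -> y != x -> (y == z) || e y z ->
  z \notin cut_side x y.
Proof.
move=> zx yx yz; rewrite !inE zx /= negbK; case/predU1P: yz => [->|yz].
  exact: connect0.
by apply: linked1; rewrite ?inE ?zx ?yx.
Qed.

Lemma cut_side_pendant x y : pendant e (cut_side x y) x.
Proof.
split=> [|p q]; first by rewrite !inE eqxx.
rewrite !inE => /andP[px nyp] qC pq; apply/eqP; apply: contraNT nyp => qx.
move: qC; rewrite qx /= negbK => yq; apply: connect_trans yq _.
by apply: linked1; rewrite ?inE ?px ?qx // e_sym.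
Qed.

Lemma cut_side_nonempty x y : articulation e [set: T] x -> exists c, c \in cut_side x y.
Proof.
case/andP=> _ /connectedPn[c [d [cA dA ncd]]].
have [cy|cy] := boolP (linked ([set: T] :\ x) y c); last first.
  by exists c; rewrite inE cy; move: cA; rewrite !inE => /andP[->].
exists d; rewrite inE; move: (dA); rewrite !inE => /andP[-> _] /=.
apply: contra ncd => yd; rewrite (linked_sym e_sym) in cy.
exact: connect_trans cy yd.
Qed.

(** An edge leaving the intersection would leave both sets, because [x] is not in [D] and [y] not in
    [C], and would thus end in [x = y]. In a connected graph a nonempty intersection would then
    contain [x]. *)
Lemma pendant_disjoint C D x y c : connected e [set: T] ->
  pendant e C x -> pendant e D y -> x \notin D -> y \notin C -> x != y ->
  c \in C -> c \notin D.
Proof.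
move=> /connectedP cG [xC exitC] [yD exitD] xD yC xy cC; apply/negP=> cD.
have cl : closed_in e [set: T] (C :&: D).
  move=> p q /setIP[pC pD] _ pq; rewrite inE.
  have [qC|qC] := boolP (q \in C); last first.
    have qx := exitC p q pC qC pq; rewrite qx in pq.
    by rewrite (exitD p x pD xD pq) eqxx in xy.
  apply: contraT => qD; have qy := exitD p q pD qD pq.
  by rewrite -qy qC in yC.
have : x \in C :&: D.
  by apply: (linked_closed cl (cG c x _ _)); rewrite ?inE ?cC.
by rewrite inE (negPf xC).
Qed.

Lemma path_cover_cond_b u v :
  connected e [set: T] -> path_cover e u v -> cond_b e u v.
Proof.
move=> cG /path_cover_segs[a [b [s [t M]]]] x y z ax ay az exy eyz exz S.
have ne p q : e p q -> p != q by apply: contraTneq => ->; rewrite e_irr.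
have nxy := ne _ _ exy; have nyz := ne _ _ eyz; have nxz := ne _ _ exz.
have eyx : e y x by rewrite e_sym.
have ezy : e z y by rewrite e_sym.
have ezx : e z x by rewrite e_sym.
pose X := cut_side x y; pose Y := cut_side y z; pose Z := cut_side z x.
have pX : pendant e X x := cut_side_pendant x y.
have pY : pendant e Y y := cut_side_pendant y z.
have pZ : pendant e Z z := cut_side_pendant z x.
have xX : x \notin X by case: pX.
have yY : y \notin Y by case: pY.
have zZ : z \notin Z by case: pZ.
have yX : y \notin X by apply: cut_side_ref; rewrite ?eqxx // eq_sym.
have zX : z \notin X by apply: cut_side_ref; rewrite ?eyz ?orbT // eq_sym.
have zY : z \notin Y by apply: cut_side_ref; rewrite ?eqxx // eq_sym.
have xY : x \notin Y by apply: cut_side_ref; rewrite ?ezx ?orbT // eq_sym.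
have xZ : x \notin Z by apply: cut_side_ref; rewrite ?eqxx.
have yZ : y \notin Z by apply: cut_side_ref; rewrite ?exy ?orbT.
(* Three disjoint pendant sets compete for the two ends. Both halves of (b) are thereby reduced to
   showing that the edge [uv] keeps these sets pendant. *)
have core :
    (forall (P : {set T}) p, p \in S -> pendant e P p ->
       (forall q, q \in S -> q \notin P) ->
       (u \in P -> v \in P \/ v = p) /\ (v \in P -> u \in P \/ u = p)) -> False.
  move=> H; have SN (P : {set T}) : x \notin P -> y \notin P -> z \notin P ->
      forall q, q \in S -> q \notin P.
    by move=> xP yP zP q; rewrite !inE => /orP[/orP[]|] /eqP->.
  have [xS yS zS] : [/\ x \in S, y \in S & z \in S].
    by rewrite !inE !eqxx !orbT.
  have [X1 X2] := H X x xS pX (SN X xX yX zX).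
  have [Y1 Y2] := H Y y yS pY (SN Y xY yY zY).
  have [Z1 Z2] := H Z z zS pZ (SN Z xZ yZ zZ).
  have [c1 c1X] := cut_side_nonempty y ax; have [c2 c2Y] := cut_side_nonempty z ay.
  have [c3 c3Z] := cut_side_nonempty x az.
  have abX := cover_pendant M pX X1 X2 c1X.
  have abY := cover_pendant M pY Y1 Y2 c2Y.
  have abZ := cover_pendant M pZ Z1 Z2 c3Z.
  have XY c := @pendant_disjoint X Y x y c cG pX pY xY yX nxy.
  have XZ c := @pendant_disjoint X Z x z c cG pX pZ xZ zX nxz.
  have YZ c := @pendant_disjoint Y Z y z c cG pY pZ yZ zY nyz.
  case/orP: abX => [aX|bX].
    move: abY abZ; rewrite (negPf (XY a aX)) (negPf (XZ a aX)) /= => /YZ bZ.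
    by rewrite (negPf bZ).
  move: abY abZ; rewrite (negPf (XY b bX)) (negPf (XZ b bX)) !orbF => /YZ aZ.
  by rewrite (negPf aZ).
split=> [uS vS C CS [uC vC]|w w' ww' wS w'S C CS wC].
  apply: core => P p pS pP SP; have uv := comp_linked e_sym v CS uC.
  rewrite vC in uv; have pA : p \notin ~: S by rewrite inE negbK.
  have vu : linked (~: S) v u by rewrite (linked_sym e_sym).
  split=> [uP|vP]; left; first exact: pendant_linked pP pA _ uP.
  exact: pendant_linked pP pA vu vP.
apply/negP=> w'C; have /exists_inP[c cC wc] := wC.
apply: core => P p pS pP SP; have pA : p \notin ~: S by rewrite inE negbK.
have wP : w \notin P := SP w wS.
(* Linked to [w'] off the triangle, [c] also lies in [P]; its edge to [w] leaves [P] and so ends in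
   the attaching vertex [p]. *)
have w'P : w' \in P -> w = p.
  move=> w'P; have w'c : linked (~: S) w' c by rewrite -(comp_linked e_sym _ CS w'C).
  have cP := pendant_linked pP pA w'c w'P.
  by case: pP => _ exitP; apply: (exitP c) => //; rewrite e_sym.
have H1 : w \in P -> w' \in P \/ w' = p by rewrite (negPf wP).
have H2 : w' \in P -> w \in P \/ w = p by move=> w'inP; right; apply: w'P.
by case: ww' => -[wE w'E]; rewrite -wE -w'E.
Qed.

(** From [c] the first path must leave [C] to reach [a], but the only exits are its own start,
    already passed, and the start of the other path. *)
Lemma cover_inner u v a b s t C c : cover u v a b s t ->
  u \notin C -> v \notin C -> a \notin C -> c \in s -> c \in C ->
  ~ (forall y z, y \in C -> z \notin C -> e y z -> z \in [:: u; v]).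
Proof.
case=> sP tP ust cov uC vC aC cs cC exitC.
have cu : c != u by apply: contraNneq uC => <-.
have [s1 [s2 [o [sE s1P _ s2P]]]] := seg_before sP cs cu.
have [z zs2] := seg_exit (X := mem [:: u; v]) s2P cC aC exitC.
rewrite !inE => /orP[]/eqP zE; rewrite {}zE in zs2; rewrite sE -?catA in ust.
  have us2 : u \in s2 ++ t by rewrite mem_cat zs2.
  by have := uniq_cat_neq ust (seg_head s1P) us2; rewrite eqxx.
rewrite catA in ust; have vs : v \in s1 ++ s2 by rewrite mem_cat zs2 orbT.
by have := uniq_cat_neq ust vs (seg_head tP); rewrite eqxx.
Qed.

Lemma path_cover_cond_d u v : path_cover e u v -> cond_d e u v.
Proof.
move=> /path_cover_segs[a [b [s [t M]]]] x Q1 y J1 xu ax _ Q1C uQ yu ay J1C uJ vJ.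
move=> J3 Nx; pose C3 := J1 :\: [set u; v].
case: (boolP [exists x' in C3, e x x' || e y x']) => [|no].
  case/exists_inP=> x'; rewrite !inE negb_or.
  move=> /andP[/andP[/eqP x'u /eqP x'v] x'J] /orP x'e.
  by exists x'.
exfalso; have noC3 p : p \in C3 -> ~~ e p x /\ ~~ e p y.
  move=> pC; apply/andP; rewrite -negb_or !(e_sym p).
  by apply: contra no => pe; apply/exists_inP; exists p.
have JQ p : p \in J1 -> (p != y) && (p \in Q1).
  by move/(comp_sub J1C); rewrite !inE.
have Qx p : p \in Q1 -> p != x by move/(comp_sub Q1C); rewrite !inE.
have Qcl p q : p \in Q1 -> q != x -> e p q -> q \in Q1.
  by move=> pQ qx; apply: (comp_closed e_sym Q1C) => //; rewrite !inE.
have Jcl p q : p \in J1 -> q != y -> q \in Q1 -> e p q -> q \in J1.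
  by move=> pJ qy qQ; apply: (comp_closed e_sym J1C) => //; rewrite !inE qy.
have /andP[vy vQ] := JQ v vJ.
(* [C1] hangs at [x]. [C2] hangs at [y], because [x] has no neighbour in [Q1] outside [J1] and [y].
   [C3] sees neither [x] nor [y], so only [u] and [v] lead out of it. *)
pose C1 := [set p | (p != x) && (p \notin Q1)].
pose C2 := [set p | [&& p != y, p \in Q1 & p \notin J1]].
have p1 : pendant e C1 x.
  split=> [|p q]; first by rewrite inE eqxx.
  rewrite !inE => /andP[px pQ] qC pq; apply/eqP; apply: contraNT pQ => qx.
  move: qC; rewrite qx /= negbK => qQ.
  by apply: Qcl qQ px _; rewrite e_sym.
have p2 : pendant e C2 y.
  split=> [|p q]; first by rewrite inE eqxx.
  rewrite !inE => /and3P[py pQ pJ] qC pq; apply/eqP; apply: contraNT pJ => qy.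
  have qp : e q p by rewrite e_sym.
  have [qx|qx] := eqVneq q x.
    by rewrite qx in qp; case: (Nx p pQ qp) => // pE; rewrite pE eqxx in py.
  move: qC; rewrite qy (Qcl p q pQ qx pq) /= negbK => qJ.
  exact: Jcl qJ py pQ qp.
have uC1 : u \notin C1 by rewrite inE uQ andbF.
have vC1 : v \notin C1 by rewrite inE vQ andbF.
have uC2 : u \notin C2 by rewrite inE uJ !andbF.
have vC2 : v \notin C2 by rewrite inE vJ !andbF.
have full (A B : {set T}) p : p \in B -> B \in components e A -> ~~ connected e A ->
    exists2 q, q \in A & q \notin B.
  move=> pB BA; case/connectedPn=> c [d [cA dA ncd]].
  have [cB|cB] := boolP (c \in B); last by exists c.
  by exists d => //; rewrite (comp_linked e_sym _ BA cB).
have [c1 c1C] : exists c, c \in C1.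
  have := andP ax; rewrite setTD => -[_ /(full _ Q1 u uQ Q1C)[c cx cQ]].
  by exists c; rewrite inE cQ; move: cx; rewrite !inE => ->.
have [c2 c2C] : exists c, c \in C2.
  have := andP ay => -[_ /(full _ J1 u uJ J1C)[c cy cJ]].
  by exists c; rewrite inE cJ; move: cy; rewrite !inE => /andP[-> ->].
have ab1 : (a \in C1) || (b \in C1).
  apply: (cover_pendant M p1 _ _ c1C) => uC; first by rewrite uC in uC1.
  by rewrite uC in vC1.
have ab2 : (a \in C2) || (b \in C2).
  apply: (cover_pendant M p2 _ _ c2C) => uC; first by rewrite uC in uC2.
  by rewrite uC in vC2.
have C31 p : p \in C1 -> p \notin C3.
  rewrite !inE => /andP[_ pQ]; apply: contra pQ => /andP[_ /JQ/andP[]] //.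
have C32 p : p \in C2 -> p \notin C3.
  by rewrite !inE => /and3P[_ _ pJ]; rewrite (negPf pJ) andbF.
have C12 p : p \in C1 -> p \notin C2.
  by rewrite !inE => /andP[_ pQ]; rewrite (negPf pQ) andbF.
(* The disjoint sets [C1] and [C2] use up both ends. *)
have [aC3 bC3] : a \notin C3 /\ b \notin C3.
  case/orP: ab1 => [a1|b1]; move: ab2.
    by rewrite (negPf (C12 a a1)) /= => b2; split; [apply: C31 | apply: C32].
  by rewrite (negPf (C12 b b1)) orbF => a2; split; [apply: C32 | apply: C31].
have [c cC] : exists c, c \in C3.
  apply/set0Pn; apply: contraTneq J3 => /eqP; rewrite setD_eq0 => /subset_leq_card.
  by rewrite -leqNgt => /leq_trans; apply; rewrite cards2; case: (u != v).
have exit3 p q : p \in C3 -> q \notin C3 -> e p q -> q \in [:: u; v].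
  move=> pC qC pq; have [npx npy] := noC3 p pC.
  have pJ : p \in J1 by move: pC; rewrite inE => /andP[].
  have /andP[_ pQ] := JQ p pJ.
  have qx : q != x by apply: contraNneq npx => <-.
  have qy : q != y by apply: contraNneq npy => <-.
  have qJ := Jcl p q pJ qy (Qcl p q pQ qx pq) pq.
  by move: qC; rewrite !inE qJ andbT negbK.
have uC3 : u \notin C3 by rewrite !inE eqxx.
have vC3 : v \notin C3 by rewrite !inE eqxx orbT.
have := cov_all M c; rewrite mem_cat => /orP[cs|ct].
  exact: (cover_inner M uC3 vC3 aC3 cs cC exit3).
apply: (cover_inner (cover_swap M) vC3 uC3 bC3 ct cC) => p q pC qC pq.
by have := exit3 p q pC qC pq; rewrite !inE orbC.
Qed.

(** As [v] lies elsewhere, [C] consists of the vertices of [s], and [s] without its first vertex is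
    still a path. *)
Lemma cover_component_end u v a b s t C : cover u v a b s t ->
  ~~ linked [set: T] u v -> C \in components e [set: T] -> u \in C ->
  ~~ articulation e C u.
Proof.
case=> sP tP ust cov nuv CT uC; rewrite /articulation uC /= negbK.
have us : uniq s by move: ust; rewrite cat_uniq => /and3P[].
have sT : {subset s <= [set: T]} by move=> z; rewrite inE.
have tT : {subset t <= [set: T]} by move=> z; rewrite inE.
have [|w wl] := tail_linked (A := C :\ u) sP us.
  move=> z zs zu; rewrite !inE zu (comp_linked e_sym _ CT uC).
  exact: seg_linked sP sT zs.
have Cs z : z \in C -> z \in s.
  rewrite (comp_linked e_sym _ CT uC) => uz; have := cov z; rewrite mem_cat.
  case/orP=> // /(seg_linked tP tT) vz; case/negP: nuv.
  by rewrite (linked_sym e_sym) in vz; apply: connect_trans uz vz.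
apply/connectedP=> y z; rewrite !inE => /andP[yu /Cs ys] /andP[zu /Cs zs].
have wy := wl y ys yu; rewrite (linked_sym e_sym) in wy.
exact: connect_trans wy (wl z zs zu).
Qed.

Lemma path_cover_cond_disconnected u v :
  ~~ connected e [set: T] -> path_cover e u v -> cond_disconnected e u v.
Proof.
move=> /card_components_ge2 c2 /path_cover_segs[a [b [s [t M]]]].
have [sP tP ust cov] := M.
have sT : {subset s <= [set: T]} by move=> z; rewrite inE.
have tT : {subset t <= [set: T]} by move=> z; rewrite inE.
have nuv : ~~ linked [set: T] u v.
  apply/negP=> uv; suff: #|components e [set: T]| <= 1 by rewrite leqNgt c2.
  apply: (@card_components_le _ e e_sym _ [:: u]) => z _; exists u; first exact: mem_head.
  have := cov z; rewrite mem_cat => /orP[zs|zt]; first exact: seg_linked sP sT zs.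
  exact: connect_trans uv (seg_linked tP tT zt).
split; last first.
- move=> C CT; split; first exact: cover_component_end M nuv CT.
  apply: cover_component_end (cover_swap M) _ CT; by rewrite (linked_sym e_sym).
- exact: separatedPn.
apply/eqP; rewrite eqn_leq c2 andbT.
apply: (@card_components_le _ e e_sym [set: T] [:: u; v]) => z _.
have := cov z; rewrite mem_cat => /orP[zs|zt].
  by exists u; rewrite ?inE ?eqxx //; apply: seg_linked sP sT zs.
by exists v; rewrite ?inE ?eqxx ?orbT //; apply: seg_linked tP tT zt.
Qed.

End Necessity.

Theorem theorem6 (T : finType) (e : rel T) (e_sym : symmetric e)
    (e_irr : irreflexive e) (G_4K1_free : free_4K1 e) (u v : T)
    (u_neq_v : u <> v) :
  (connected e [set: T] ->
    (path_cover e u v <->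
      [/\ cond_a e u v, cond_b e u v, cond_c e u v & cond_d e u v])) /\
  (~~ connected e [set: T] ->
    (path_cover e u v <-> cond_disconnected e u v)).
Proof.
split=> cG; split.
- move=> pc; split.
  + exact: path_cover_cond_a.
  + exact: path_cover_cond_b.
  + exact: path_cover_cond_c.
  + exact: path_cover_cond_d.
- by apply: connected_path_cover => //; apply/eqP.
- exact: path_cover_cond_disconnected.
- exact: disconnected_path_cover.
Qed.
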